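(* Let $n\ge 4$. (a) Suppose that $G\subseteq \mathfrak{S}_{n-1}$ acts on $\overline{\mathcal M}_{0,n}$ by permuting the first $n-1$ marked points and leaving the $n$th point invariant. Then the action of $G$ on $\overline{\mathcal M}_{0,n}$ is linearizable. (b) For $n=2m+1$ odd and any subgroup $G\subseteq \mathfrak{S}_{2m+1}$, the $G$-action on $\overline{\mathcal M}_{0,n}$ is stably linearizable. (c) More generally, for any subgroup $G\subseteq\mathfrak{S}_n$ leaving an odd cycle invariant (i.e., leaving invariant a subset of odd cardinality of $\{1,\dots,n\}$), the $G$-action on $\overline{\mathcal M}_{0,n}$ is stably linearizable.
   Context: $\overline{\mathcal M}_{0,n}$ is the moduli space of stable $n$-pointed curves of genus zero over a ground field; $\mathfrak{S}_n$ acts on it by permuting the marked points. A generically free regular action of a finite group $G$ on a projective variety $X$ is linearizable if $X$ is $G$-equivariantly birational to $\mathbb{P}(V)$ for a linear representation $V$ of $G$; it is stably linearizable if $X\times\mathbb{P}^r$, with trivial action on the second factor, is linearizable for some $r$. *)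

(* Defs.v *)
From HB Require Import structures.
From mathcomp Require Import all_boot all_order all_fingroup all_algebra.
From mathcomp Require Import mxrepresentation.
From mathcomp Require Import mpoly.

Set Implicit Arguments.
Unset Strict Implicit.
Unset Printing Implicit Defensive.

Import GRing.Theory.
Local Open Scope ring_scope.

(* Classical varieties over a ground field k: sets of points with coordinates
   in an algebraically closed extension K of k, while the maps between them are
   given by polynomials over k.                                               *)

(* A product of projective spaces, one for each element of [factor]; the
   homogeneous coordinates of the i-th one are the j with [blk j = i].        *)
Record mspace := MSpace {
  factor : finType;
  coord : finType;
  blk : coord -> factor }.

(* m homogeneous coordinates, that is, the space P^(m-1). *)
Definition projsp (m : nat) : mspace :=
  @MSpace unit 'I_m (fun=> tt).

Definition prodsp (S T : mspace) : mspace :=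
  @MSpace (factor S + factor T)%type (coord S + coord T)%type
    (fun j => match j with inl a => inl (blk a) | inr b => inr (blk b) end).

Section Varieties.

Variables (k : fieldType) (K : closedFieldType) (iota : {rmorphism k -> K}).

(* Points are handled through their homogeneous coordinates, up to [eqpt]. *)
Definition vec (S : mspace) := coord S -> K.

Definition is_pt (S : mspace) (x : vec S) : Prop :=
  forall i : factor S, exists2 j, blk j = i & x j != 0.

Definition eqpt (S : mspace) (x y : vec S) : Prop :=
  exists2 c : factor S -> K,
    forall i, c i != 0 & forall j, y j = c (blk j) * x j.

Definition mhomog (S : mspace) (L : fieldType) (d : factor S -> nat)
    (p : {mpoly L[#|coord S|]}) : Prop :=
  forall mon : 'X_{1..#|coord S|}, mon \in msupp p ->
    forall i : factor S, (\sum_(j | blk (enum_val j) == i) mon j)%N = d i.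

(* U is Zariski dense in X: a multihomogeneous form vanishing on U vanishes on
   X.                                                                         *)
Definition dense (S : mspace) (X U : vec S -> Prop) : Prop :=
  forall (d : factor S -> nat) (p : {mpoly K[#|coord S|]}), mhomog d p ->
    (forall x, X x -> U x -> p.@[fun j => x (enum_val j)] = 0) ->
    forall x, X x -> p.@[fun j => x (enum_val j)] = 0.

(* A k-rational map between products of projective spaces: for each factor i
   of T, the coordinates of that factor are forms over k of the same
   multidegree. It is defined at x when [is_pt (rapp F x)]. Every k-rational
   map on an irreducible variety is represented by such forms on a dense open
   subset.                                                                    *)
Record ratmap (S T : mspace) := RatMap {
  rform : coord T -> {mpoly k[#|coord S|]};
  rdeg : factor T -> factor S -> nat;
  rform_homog : forall j, mhomog (rdeg (blk j)) (rform j) }.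

Definition rapp (S T : mspace) (F : ratmap S T) (x : vec S) : vec T :=
  fun j => mmap iota (fun l => x (enum_val l)) (rform F j).

Section Actions.

Variables (gT : finGroupType) (G : {group gT}).

(* As always in MathComp, groups act on the right. The last condition says that
   each [act g] is a morphism: locally given by forms over k.                 *)
Definition regular_action (S : mspace) (X : vec S -> Prop)
    (act : gT -> vec S -> vec S) : Prop :=
  [/\ forall g x, g \in G -> X x -> X (act g x),
      forall x, X x -> eqpt (act 1%g x) x,
      forall g h x, g \in G -> h \in G -> X x ->
        eqpt (act (g * h)%g x) (act h (act g x))
    & forall g x, g \in G -> X x -> exists F : ratmap S S,
        is_pt (rapp F x) /\
        forall y, X y -> is_pt (rapp F y) -> eqpt (act g y) (rapp F y)].

(* The locus of points with trivial stabilizer is open, as G is finite. *)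
Definition generically_free (S : mspace) (X : vec S -> Prop)
    (act : gT -> vec S -> vec S) : Prop :=
  dense X (fun x => forall g, g \in G -> eqpt (act g x) x -> g = 1%g).

Definition equivariant (S T : mspace) (X : vec S -> Prop)
    (actS : gT -> vec S -> vec S) (actT : gT -> vec T -> vec T)
    (F : ratmap S T) : Prop :=
  forall g x, g \in G -> X x ->
    is_pt (rapp F x) -> is_pt (rapp F (actS g x)) ->
    eqpt (rapp F (actS g x)) (actT g (rapp F x)).

(* F' o F is defined on a dense (open) subset of X, and is the identity. *)
Definition ratinverse (S T : mspace) (X : vec S -> Prop)
    (F : ratmap S T) (F' : ratmap T S) : Prop :=
  dense X (fun x => is_pt (rapp F x) /\ is_pt (rapp F' (rapp F x))) /\
  forall x, X x -> is_pt (rapp F x) -> is_pt (rapp F' (rapp F x)) ->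
    eqpt x (rapp F' (rapp F x)).

Definition equiv_birational (S T : mspace)
    (X : vec S -> Prop) (actS : gT -> vec S -> vec S)
    (Y : vec T -> Prop) (actT : gT -> vec T -> vec T) : Prop :=
  exists (F : ratmap S T) (F' : ratmap T S),
    [/\ forall x, X x -> is_pt (rapp F x) -> Y (rapp F x),
        forall y, Y y -> is_pt (rapp F' y) -> X (rapp F' y),
        ratinverse X F F' /\ ratinverse Y F' F
      & equivariant X actS actT F /\ equivariant Y actT actS F'].

Definition repr_act (m : nat) (rG : mx_representation k G m)
    (g : gT) (v : vec (projsp m)) : vec (projsp m) :=
  fun j => \sum_(i < m) v i * iota (rG g i j).

Definition linearizable (S : mspace) (X : vec S -> Prop)
    (act : gT -> vec S -> vec S) : Prop :=
  [/\ regular_action X act,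
      generically_free X act
    & exists (m : nat) (rG : mx_representation k G m),
        equiv_birational X act (@is_pt (projsp m)) (repr_act rG)].

Definition prodset (S T : mspace) (X : vec S -> Prop) (Y : vec T -> Prop)
    (z : vec (prodsp S T)) : Prop :=
  X (fun a => z (inl a)) /\ Y (fun b => z (inr b)).

Definition prodact (S T : mspace) (act : gT -> vec S -> vec S)
    (g : gT) (z : vec (prodsp S T)) : vec (prodsp S T) :=
  fun j => match j with
           | inl a => act g (fun a' => z (inl a')) a
           | inr b => z (inr b)
           end.

Definition stably_linearizable (S : mspace) (X : vec S -> Prop)
    (act : gT -> vec S -> vec S) : Prop :=
  exists r : nat,
    linearizable (prodset X (@is_pt (projsp r.+1)))
                 (prodact (T := projsp r.+1) act).

End Actions.
End Varieties.

Section StableCurves.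

Variable K : closedFieldType.

(* u and v are the same point of P^1 iff [det2 u v = 0]. *)
Definition det2 (u v : 'rV[K]_2) : K := u 0 0 * v 0 1 - u 0 1 * v 0 0.

Definition special (n : nat) (comp : finType) (adj : rel comp)
    (mark : 'I_n -> comp) (v : comp) : pred (comp + 'I_n) :=
  fun s => match s with inl w => adj v w | inr i => mark i == v end.

(* Stable n-pointed curves of genus zero over the algebraically closed field K:
   trees of projective lines, joined at nodes, with at least three special
   points on each component. [adj v w] says that the components v and w meet;
   the special points on v are the nodes [inl w] with [adj v w] and the marked
   points [inr i] with [mark i = v], and [pos v s] is the position of the
   special point s on v, a copy of P^1. As v carries other special points,
   [curve_pos] forces [pos v s] to be nonzero.                                *)
Record stable_curve (n : nat) := StableCurve {
  comp : finType;
  adj : rel comp;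
  mark : 'I_n -> comp;
  pos : comp -> comp + 'I_n -> 'rV[K]_2;
  adj_sym : ssrbool.symmetric adj;
  adj_irr : irreflexive adj;
  curve_connected : forall v w, connect adj v w;
  curve_acyclic : forall p : seq comp, (2 < size p)%N -> ~ ucycle adj p;
  curve_pos : forall v,
    {in special adj mark v &,
      forall s t, s != t -> det2 (pos v s) (pos v t) != 0};
  curve_stable : forall v, (3 <= #|special adj mark v|)%N }.

(* s is the special point of v at which the i-th marked point is seen from v:
   that point itself if it lies on v, otherwise the node of v leading to it.  *)
Definition towards (n : nat) (C : stable_curve n) (v : comp C) (i : 'I_n)
    (s : comp C + 'I_n) : bool :=
  match s with
  | inl w => adj v w &&
      connect [rel a b | [&& adj a b, a != v & b != v]] w (mark C i)
  | inr j => (j == i) && (mark C i == v)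
  end.

(* (0, 0) precisely when three of the four points coincide. *)
Definition cross_ratio (z : 'I_4 -> 'rV[K]_2) : 'rV[K]_2 :=
  \row_(a < 2) if a == 0 then det2 (z 0) (z 2) * det2 (z 1) (z 3)
               else det2 (z 0) (z 3) * det2 (z 1) (z 2).

Definition quad (n : nat) := {q : {ffun 'I_4 -> 'I_n} | injectiveb q}.

Definition crsp (n : nat) : mspace :=
  @MSpace (quad n) (quad n * 'I_2)%type fst.

(* x is the point of (P^1)^(quad n) whose q-coordinate is the image of C under
   the forgetful map to \bar M_{0,4} = P^1 keeping the points marked by q. This
   is the cross-ratio of those points as seen from any component v from which
   no three of them are seen at the same point; there is at least one such v,
   they all give the same value, and for the others the equation is 0 = 0.    *)
Definition moduli_point (n : nat) (C : stable_curve n) (x : vec K (crsp n)) :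
    Prop :=
  is_pt x /\
  forall (q : quad n) (v : comp C) (s : 'I_4 -> comp C + 'I_n),
    (forall a, towards v (val q a) (s a)) ->
    det2 (\row_a x (q, a)) (cross_ratio (fun a => pos v (s a))) = 0.

(* The moduli space of stable n-pointed curves of genus zero (n >= 4). A stable
   curve is determined up to isomorphism by its cross-ratios, so the points of
   [Mbar n] are the isomorphism classes of such curves; the variety structure
   is that of a closed subvariety of a product of copies of \bar M_{0,4} = P^1,
   embedded by the forgetful maps (Gerritzen-Herrlich-van der Put, Stable
   n-pointed trees of projective lines).                                      *)
Definition Mbar (n : nat) (x : vec K (crsp n)) : Prop :=
  exists C : stable_curve n, moduli_point C x.

Lemma quad_perm_subproof (n : nat) (s : 'S_n) (q : quad n) :
  injectiveb [ffun a => s (val q a)].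
Proof.
apply/injectiveP => a b; rewrite !ffunE => /perm_inj.
exact: (injectiveP _ (valP q)).
Qed.

Definition quad_perm (n : nat) (s : 'S_n) (q : quad n) : quad n :=
  exist _ [ffun a => s (val q a)] (quad_perm_subproof s q).

(* Permutation of the marked points: the i-th marked point becomes the
   (s i)-th one; see [Mbar_act_relabel].                                      *)
Definition Mbar_act (n : nat) (s : 'S_n) (x : vec K (crsp n)) :
    vec K (crsp n) :=
  fun j => x (quad_perm s^-1 j.1, j.2).

Section Relabel.

Variables (n : nat) (s : 'S_n) (C : stable_curve n).

Let unlabel (t : comp C + 'I_n) : comp C + 'I_n :=
  match t with inl w => inl w | inr i => inr ((s^-1)%g i) end.

Let unlabel_inj : injective unlabel.
Proof.
by case=> [a|a] [b|b] //= ab; congr inr; apply: (@perm_inj _ s^-1%g); case: ab.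
Qed.

Let rmark (i : 'I_n) : comp C := mark C ((s^-1)%g i).
Let rpos (v : comp C) (t : comp C + 'I_n) := pos v (unlabel t).

Let rspecialE v t :
  (t \in special (@adj n C) rmark v) =
  (unlabel t \in special (@adj n C) (@mark n C) v).
Proof. by case: t. Qed.

Let rcurve_pos v :
  {in special (@adj n C) rmark v &,
    forall t u, t != u -> det2 (rpos v t) (rpos v u) != 0}.
Proof.
move=> t u; rewrite !rspecialE => ht hu tu; apply: curve_pos => //.
by rewrite (inj_eq unlabel_inj).
Qed.

Let rcurve_stable v : (3 <= #|special (@adj n C) rmark v|)%N.
Proof.
apply: leq_trans (curve_stable v) _; rewrite (eq_card (rspecialE v)).
rewrite (card_preim unlabel_inj (special (@adj n C) (@mark n C) v)).
apply: subset_leq_card; apply/subsetP => t ht; rewrite inE ht andbT.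
apply/codomP; case: t ht => [w|i] _; first by exists (inl w).
by exists (inr (s i)); rewrite /= permK.
Qed.

Definition relabel : stable_curve n :=
  @StableCurve n (comp C) (@adj n C) rmark rpos (@adj_sym n C) (@adj_irr n C)
    (@curve_connected n C) (@curve_acyclic n C) rcurve_pos rcurve_stable.

Lemma mark_relabel i : mark relabel (s i) = mark C i.
Proof. by rewrite /= /rmark permK. Qed.

Lemma Mbar_act_relabel x :
  moduli_point C x -> moduli_point relabel (Mbar_act s x).
Proof.
move=> [xpt xC]; split=> [q|q v t tq].
  have [[q' c] /= q'E xc] := xpt (quad_perm s^-1 q).
  by exists (q, c) => //; rewrite /Mbar_act /= -q'E.
apply: (xC (quad_perm s^-1 q) v (fun a => unlabel (t a))) => a.
have := tq a; rewrite /quad_perm /= ffunE.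
case: (t a) => [w|j] //= /andP[/eqP -> h].
by rewrite eqxx.
Qed.

End Relabel.

End StableCurves.

(* Main.v *)
Require Import Defs.
From mathcomp Require Import all_boot all_order all_fingroup all_algebra.
From mathcomp Require Import mxrepresentation.
From mathcomp Require Import mpoly.
From mathcomp Require Import ring.
Import Defs.

Set Implicit Arguments.
Unset Strict Implicit.
Unset Printing Implicit Defensive.

Import GRing.Theory.
Local Open Scope ring_scope.

(* Sending one marked point to infinity identifies a smooth n-pointed curve with
   n - 1 distinct points of the affine line up to affine maps, that is, with a
   point of P(k^(n-1)/k); this is equivariant when the point is fixed, hence (a).

   For (b) and (c), a smooth curve with n points u_i and one more point z is a
   point of M_{0,n+1}, which is linearizable by (a). If a set A of odd size is
   preserved, averaging over G products of brackets det(u_i, u_j) with a vector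
   u_a gives covariants L_0, L_1 with values in k^2, of the same multidegree
   (odd in the points of A, even in the others), and Lagrange interpolation on a
   free orbit makes them independent. Then (det(L_0, z) : det(L_1, z)) is a
   G-invariant coordinate on the fibre of M_{0,n+1} -> M_{0,n}, and identifies
   M_{0,n+1} with M_{0,n} x P^1.

   Singular curves matter only for density: they are the limits of smooth ones,
   obtained by gluing neighbouring components with a parameter t. The
   cross-ratio of four points can be computed from any component, and it has
   its limit visibly at a component from which no three of them are seen at the
   same point; up to powers of t, the other components give the same value. *)

(** * Polynomial maps with integer coefficients *)

(** The field [k] is arbitrary: its characteristic may divide the order of G, and the maps need
    coefficients in [k]. So the covariants are plain sums over G with integer coefficients; the
    interpolation, whose coefficients lie in [K], serves only to show that they are not all
    parallel. Parity is a matter of weights. For (det(L_0, z) : det(L_1, z)) not to depend on the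
    vectors chosen for the points, all terms of L_0 and L_1 need one multidegree, invariant under G.
    A term is a vector u_a times brackets, so its total degree is odd: the set A of points of odd
    degree is invariant and of odd size. Conversely, if A is odd, the points of A other than [a] can
    be matched in pairs. If A is a single point a, all covariants are multiples of u_a; A is then
    replaced by a larger odd invariant set. Configurations are compared through their brackets only,
    by the relation [sim], so no matrices of projective maps are needed. *)

(* Such a map is handled as a family of functions, one for each commutative
   ring, that commute with ring morphisms. Evaluating it at indeterminates
   gives forms over the ground field, at points gives the rational map, and at
   univariate polynomials gives one-parameter families. *)
Definition nfun (I J : Type) := forall R : comNzRingType, (I -> R) -> J -> R.

Definition natural (I J : Type) (F : nfun I J) :=
  forall (R R' : comNzRingType) (f : {rmorphism R -> R'}) x x',
    (forall i, x' i = f (x i)) -> forall j, F R' x' j = f (F R x j).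

Definition graded (S T : mspace) (F : nfun (coord S) (coord T))
    (d : factor T -> factor S -> nat) :=
  forall (R : comNzRingType) (c : factor S -> R) x j,
    F R (fun l => c (blk l) * x l) j
    = (\prod_i c i ^+ d (blk j) i) * F R x j.

Record natmap (S T : mspace) := NatMap {
  nm :> forall R : comNzRingType, (coord S -> R) -> coord T -> R;
  nm_deg : factor T -> factor S -> nat;
  nm_nat : natural nm;
  nm_graded : graded nm nm_deg }.

Lemma natural_ext (I J : Type) (F : nfun I J) (R : comNzRingType)
    (x x' : I -> R) :
  natural F -> x =1 x' -> F R x =1 F R x'.
Proof. by move=> natF xx' j; rewrite (natF R R idfun x' x). Qed.

Lemma natural_comp (I J L : Type) (F : nfun I J) (G : nfun J L) :
  natural F -> natural G -> natural (fun R x => G R (F R x)).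
Proof.
by move=> natF natG R R' f x x' xx' l; apply: natG => j; apply: natF.
Qed.

Lemma expr_prod_deg (R : comNzRingType) (I J : finType) (c : I -> R)
    (a : J -> I -> nat) (b : J -> nat) :
  \prod_j (\prod_i c i ^+ a j i) ^+ b j
  = \prod_i c i ^+ (\sum_j a j i * b j)%N.
Proof.
under eq_bigr => j _ do rewrite -prodrXl.
rewrite exchange_big /=; apply: eq_bigr => i _.
under eq_bigr => j _ do rewrite -exprM.
by rewrite prodrXr.
Qed.

Lemma prod_sum_eq (R : comNzRingType) (I J : finType) (c : I -> R)
    (f : J -> I) :
  \prod_i c i ^+ (\sum_j (f j == i))%N = \prod_j c (f j).
Proof.
under eq_bigr => i _ do rewrite -prodrXr.
rewrite exchange_big /=; apply: eq_bigr => j _.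
rewrite (bigD1 (f j)) //= eqxx big1 ?mulr1 // => i /negPf ij.
by rewrite eq_sym ij.
Qed.

Lemma prod_pred1 (R : comNzRingType) (I : finType) (c : I -> R) (i0 : I) :
  \prod_i c i ^+ (i0 == i) = c i0.
Proof.
rewrite (bigD1 i0) //= eqxx big1 ?mulr1 // => i /negPf ij.
by rewrite eq_sym ij.
Qed.

Section NatMap.

Variables S T U : mspace.

Lemma nm_ext (F : natmap S T) (R : comNzRingType) (x x' : coord S -> R) :
  x =1 x' -> F R x =1 F R x'.
Proof. exact/natural_ext/nm_nat. Qed.

Lemma comp_nm_graded (G : natmap T U) (F : natmap S T) :
  graded (fun R x => G R (F R x))
         (fun u i => \sum_t nm_deg F t i * nm_deg G u t)%N.
Proof.
move=> R c x j.
rewrite (natural_ext (nm_nat G) (nm_graded F c x)).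
rewrite (nm_graded G (fun t => \prod_i c i ^+ nm_deg F t i)).
by rewrite expr_prod_deg.
Qed.

Definition comp_nm (G : natmap T U) (F : natmap S T) : natmap S U :=
  NatMap (natural_comp (nm_nat F) (nm_nat G)) (comp_nm_graded G F).

Lemma mul_nm_nat (D : natmap S (projsp 1)) (F : natmap S T) :
  natural (fun R x j => D R x ord0 * F R x j).
Proof.
by move=> R R' f x x' xx' j; rewrite rmorphM; congr (_ * _); apply: nm_nat.
Qed.

Lemma mul_nm_graded (D : natmap S (projsp 1)) (F : natmap S T) :
  graded (fun R x j => D R x ord0 * F R x j)
         (fun t i => nm_deg D tt i + nm_deg F t i)%N.
Proof.
move=> R c x j; rewrite !nm_graded /= mulrACA; congr (_ * _).
by rewrite -big_split; apply: eq_bigr => i _; rewrite exprD.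
Qed.

Definition mul_nm (D : natmap S (projsp 1)) (F : natmap S T) : natmap S T :=
  NatMap (mul_nm_nat D F) (mul_nm_graded D F).

Lemma perm_nm_nat (I J : Type) (f : J -> I) :
  natural (fun R (x : I -> R) j => x (f j)).
Proof. by move=> R R' g x x' xx' j; rewrite xx'. Qed.

Lemma perm_nm_graded (f : coord T -> coord S) (fb : factor T -> factor S)
    (fE : forall j, blk (f j) = fb (blk j)) :
  graded (fun R (x : coord S -> R) j => x (f j)) (fun t i => fb t == i).
Proof. by move=> R c x j; rewrite fE prod_pred1. Qed.

Definition perm_nm f fb fE : natmap S T :=
  NatMap (@perm_nm_nat _ _ f) (@perm_nm_graded f fb fE).

End NatMap.

Lemma eq_mmap (n : nat) (A B : nzRingType) (f : A -> B) (h h' : 'I_n -> B) :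
  h =1 h' -> mmap f h =1 mmap f h'.
Proof.
by move=> hh' p; apply: eq_bigr => m _; rewrite (mmap1_eq _ hh').
Qed.

Section Forms.

Variables S T : mspace.

Section Scale.

Variables (L : fieldType) (R : comNzRingType) (h : {rmorphism L -> R}).

Lemma mmap1_scale (c : factor S -> R) (x : coord S -> R)
    (mon : 'X_{1..#|coord S|}) :
  mmap1 (fun l => c (blk (enum_val l)) * x (enum_val l)) mon
  = \prod_i c i ^+ (\sum_(j | blk (enum_val j) == i) mon j)%N
    * mmap1 (fun l => x (enum_val l)) mon.
Proof.
rewrite /mmap1 /=; under eq_bigr => l _ do rewrite exprMn.
rewrite big_split /=; congr (_ * _).
rewrite (partition_big (fun l => blk (enum_val l)) predT) //=.
apply: eq_bigr => i _; rewrite -prodrXr; apply: eq_bigr => l /eqP ->.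
by [].
Qed.

Lemma mhomog_scale (d : factor S -> nat) (p : {mpoly L[#|coord S|]})
    (c : factor S -> R) (x : coord S -> R) : mhomog d p ->
  mmap h (fun l => c (blk (enum_val l)) * x (enum_val l)) p
  = \prod_i c i ^+ d i * mmap h (fun l => x (enum_val l)) p.
Proof.
move=> hp; rewrite /mmap mulr_sumr [LHS]big_seq [RHS]big_seq.
apply: eq_bigr => mon hm; rewrite mmap1_scale mulrCA; congr (_ * (_ * _)).
by apply: eq_bigr => i _; rewrite hp.
Qed.

End Scale.

(* Weighting the coordinates of the factor [i] by an indeterminate. *)
Lemma scale_mhomog (L : fieldType) (d : factor S -> nat)
    (p : {mpoly L[#|coord S|]}) :
  (forall i, mmap (polyC \o @mpolyC #|coord S| L)
      (fun l => 'X ^+ (blk (enum_val l) == i) * ('X_l)%:P) p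
    = 'X ^+ d i * p%:P) ->
  mhomog d p.
Proof.
move=> hp mon hm i; have {hp} := hp i.
pose wt (m : 'X_{1..#|coord S|}) := (\sum_(j | blk (enum_val j) == i) m j)%N.
have -> : mmap (polyC \o @mpolyC #|coord S| L)
      (fun l => 'X ^+ (blk (enum_val l) == i) * ('X_l)%:P) p
    = \sum_(m <- msupp p) 'X^(wt m) * (p@_m *: 'X_[m])%:P.
  rewrite /mmap; apply: eq_bigr => m _.
  rewrite -mul_mpolyC polyCM mulrCA; congr (_ * _).
  rewrite /mmap1 /=; under eq_bigr => l _ do rewrite exprMn.
  rewrite big_split /=; congr (_ * _); last first.
    rewrite mpolyXE_id rmorph_prod /=.
    by apply: eq_bigr => l _; rewrite rmorphXn.
  under eq_bigr => l _ do rewrite -exprM.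
  rewrite prodrXr; congr (_ ^+ _); rewrite [RHS]big_mkcond /=.
  by apply: eq_bigr => l _; case: eqP => _; rewrite ?mul1n ?mul0n.
(* The coefficient of ['X^(wt mon)] keeps on the left the monomials of weight [wt mon]; on the right
   it is [p] if [wt mon = d i] and 0 otherwise, so [mon] can occur only in the first case. *)
move/(congr1 (fun q : {poly {mpoly L[#|coord S|]}} => q`_(wt mon))).
rewrite coef_sum [RHS]coefXnM coefC -/(wt mon).
have cE m : ('X^(wt m) * (p@_m *: 'X_[m])%:P)`_(wt mon)
    = if wt m == wt mon then p@_m *: 'X_[m] else 0 :> {mpoly L[#|coord S|]}.
  rewrite coefXnM coefC; case: ltngtP => [//|h|->]; last by rewrite subnn.
  by rewrite subn_eq0 leqNgt h.
rewrite (eq_bigr (fun m => if wt m == wt mon then p@_m *: 'X_[m] else 0)) =>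
  [|m _]; last exact: cE.
move/(congr1 (mcoeff mon)); rewrite raddf_sum /=.
rewrite (bigD1_seq mon) ?msupp_uniq //= eqxx mcoeffZ mcoeffX eqxx mulr1.
rewrite big1 => [|m /negPf mm]; last first.
  by case: eqP; rewrite ?mcoeff0 // mcoeffZ mcoeffX mm mulr0.
rewrite addr0 => pE.
have : p@_mon != 0 by rewrite -mcoeff_msupp.
rewrite pE; case: ltngtP => [|h|<-//]; first by rewrite mcoeff0 eqxx.
by rewrite subn_eq0 leqNgt h mcoeff0 eqxx.
Qed.

Variables (k : fieldType) (F : natmap S T).

Definition nm_form (j : coord T) : {mpoly k[#|coord S|]} :=
  F _ (fun l => 'X_(enum_rank l)) j.

Lemma mmap_nm_form (R : comNzRingType) (h : {rmorphism k -> R})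
    (x : coord S -> R) j :
  mmap h (fun l => x (enum_val l)) (nm_form j) = F R x j.
Proof.
rewrite /nm_form; apply/esym.
apply: (nm_nat F (f := mmap h (fun l => x (enum_val l)))) => l.
by rewrite /= mmapX mmap1U enum_rankK.
Qed.

Lemma nm_form_homog j : mhomog (nm_deg F (blk j)) (nm_form j).
Proof.
apply: scale_mhomog => i.
pose h : {rmorphism k -> {poly {mpoly k[#|coord S|]}}} :=
  polyC \o @mpolyC #|coord S| k.
pose x (l : coord S) : {poly {mpoly k[#|coord S|]}} := ('X_(enum_rank l))%:P.
pose c (i' : factor S) : {poly {mpoly k[#|coord S|]}} := 'X ^+ (i' == i).
have := mmap_nm_form h (fun l => c (blk l) * x l) j.
rewrite (nm_graded F c x).
have -> : F _ x j = (nm_form j)%:P.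
  by rewrite -[RHS]/(polyC _) -(nm_nat F (f := polyC) (x' := x)).
have -> : \prod_i' c i' ^+ nm_deg F (blk j) i' = 'X ^+ nm_deg F (blk j) i.
  rewrite (bigD1 i) //= /c eqxx big1 ?mulr1 // => i' /negPf ->.
  by rewrite expr1n.
move=> E; apply: etrans E; apply: eq_mmap => l.
by rewrite /x enum_valK.
Qed.

Definition ratmap_of : ratmap k S T :=
  @RatMap k S T nm_form (nm_deg F) nm_form_homog.

Lemma rapp_ratmap (K : closedFieldType) (iota : {rmorphism k -> K})
    (x : vec K S) j :
  rapp iota ratmap_of x j = F K x j.
Proof. exact: mmap_nm_form. Qed.

End Forms.

(** * Generic points and density *)

Section Generic.

Variable K : closedFieldType.

Lemma poly_vanish (p : {poly K}) : (forall s, p.[s] = 0) -> p = 0.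
Proof.
move=> p0; apply/eqP/negPn/negP => /closed_nonrootP[s].
by rewrite /root p0 eqxx.
Qed.

Lemma mmap_comp (n : nat) (A B C : comNzRingType) (f : {rmorphism A -> B})
    (g : {rmorphism B -> C}) (x : 'I_n -> B) (p : {mpoly A[n]}) :
  g (mmap f x p) = mmap (g \o f) (g \o x) p.
Proof.
rewrite /mmap rmorph_sum; apply: eq_bigr => m _.
rewrite rmorphM /mmap1 rmorph_prod; congr (_ * _); apply: eq_bigr => l _.
by rewrite rmorphXn.
Qed.

Definition line (I : Type) (v v' : I -> K) (i : I) : {poly K} :=
  (v i)%:P + 'X * (v' i - v i)%:P.

Lemma horner_line (I : Type) (v v' : I -> K) i s :
  (line v v' i).[s] = v i + s * (v' i - v i).
Proof. by rewrite /line !hornerE. Qed.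

Lemma natural_horner (I J : Type) (F : nfun I J) (v : I -> {poly K}) s j :
  natural F -> (F _ v j).[s] = F K (fun i => (v i).[s]) j.
Proof.
move=> natF; rewrite -[LHS]/(horner_eval s _).
by rewrite -(natF _ _ _ v (fun i => (v i).[s])).
Qed.

Lemma natural_line (I J : Type) (F : nfun I J) (v v' : I -> K) j :
  natural F -> ((F _ (line v v') j).[0] = F K v j)
    * ((F _ (line v v') j).[1] = F K v' j).
Proof.
move=> natF; split; rewrite natural_horner //; apply: natural_ext => // i.
  by rewrite horner_line mul0r addr0.
by rewrite horner_line mul1r addrC subrK.
Qed.

(* On the line joining two points where they do not vanish, two polynomials
   have only finitely many zeros. *)
Lemma generic_point2 (I J J' : Type) (F : nfun I J) (G : nfun I J')
    (v v' : I -> K) j j' :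
  natural F -> natural G -> F K v j != 0 -> G K v' j' != 0 ->
  exists w, F K w j != 0 /\ G K w j' != 0.
Proof.
move=> natF natG Fv Gv'.
have nz : F _ (line v v') j * G _ (line v v') j' != 0.
  rewrite mulf_neq0 //.
    by apply: contra Fv => /eqP h; rewrite -(natural_line v v' j natF).1 h horner0.
  by apply: contra Gv' => /eqP h; rewrite -(natural_line v v' j' natG).2 h horner0.
have [s] := closed_nonrootP _ nz.
rewrite /root hornerM !natural_horner // mulf_eq0 negb_or => /andP[? ?].
by exists (fun i => (line v v' i).[s]).
Qed.

Lemma generic_point (I : Type) (T : eqType) (s : seq T) (F : T -> nfun I 'I_1) :
  (forall t, natural (F t)) ->
  (forall t, t \in s -> exists v, F t K v ord0 != 0) ->
  exists v, forall t, t \in s -> F t K v ord0 != 0.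
Proof.
move=> natF Fs.
pose G (u : seq T) : nfun I 'I_1 := fun R v j => \prod_(t <- u) F t R v j.
have natG u : natural (G u).
  move=> R R' f x x' xx' j; rewrite rmorph_prod.
  by apply: eq_bigr => t _; apply: natF.
suff [v Gv] : exists v, G s K v ord0 != 0.
  exists v => t ts; apply: contra Gv => /eqP h.
  by rewrite /G (big_rem t) //= h mul0r.
elim: s Fs => [|t s IHs] Fs; first by exists (fun=> 0); rewrite /G big_nil oner_neq0.
have [v Fv] := Fs t (mem_head _ _).
have [|v' Gv'] := IHs; first by move=> u us; apply: Fs; rewrite inE us orbT.
have [w [Fw Gw]] := generic_point2 (natF t) (natG s) Fv Gv'.
by exists w; rewrite /G big_cons mulf_neq0.
Qed.

(** A form that vanishes on the generic points [Phi K v] vanishes on all of them, hence on families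
    over K[X]. A family may vanish identically in some factor at ['X = 0]; the multipliers [c] and
    [c'] remove the common powers of ['X] before specialising, which a multihomogeneous form
    allows. *)
Lemma dense_param (S : mspace) (X U : vec K S -> Prop) (I : Type)
    (Phi : nfun I (coord S)) (D : nfun I 'I_1) :
  natural Phi -> natural D ->
  (exists v, D K v ord0 != 0) ->
  (forall v, D K v ord0 != 0 -> X (Phi K v) /\ U (Phi K v)) ->
  (forall x, X x -> exists (v : I -> {poly K}) (y : coord S -> {poly K})
      (c c' : factor S -> {poly K}),
      [/\ forall i, c i != 0, forall i, c' i != 0,
          forall j, c (blk j) * Phi _ v j = c' (blk j) * y j
        & forall j, (y j).[0] = x j]) ->
  dense X U.
Proof.
move=> natP natD [v0 Dv0] XU lim d f homf f0.
(* On the line from [v] to [v0] the product of the form with [D] is identically zero and [D] is not,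
   so the form vanishes at [Phi K v] even where [D] does. *)
have Phi0 v : mmap idfun (fun l => Phi K v (enum_val l)) f = 0.
  pose g := mmap polyC (fun l => Phi _ (line v v0) (enum_val l)) f.
  have gE s : g.[s] = f.@[fun l => Phi K (fun i => (line v v0 i).[s]) (enum_val l)].
    rewrite -[LHS]/(horner_eval s _) mmap_comp /meval /mmap.
    apply: eq_bigr => m _; rewrite /= /horner_eval hornerC; congr (_ * _).
    by apply: mmap1_eq => l; rewrite /= /horner_eval natural_horner.
  have : g * D _ (line v v0) ord0 = 0.
    apply: poly_vanish => s; rewrite hornerM natural_horner // gE.
    have [->|Ds] := eqVneq (D K (fun i => (line v v0 i).[s]) ord0) 0.
      by rewrite mulr0.
    by have [? ?] := XU _ Ds; rewrite f0 ?mul0r.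
  move/eqP; rewrite mulf_eq0 => /orP[/eqP g0|/eqP h]; last first.
    by move: Dv0; rewrite -(natural_line v v0 ord0 natD).2 h horner0 eqxx.
  have := gE 0; rewrite g0 horner0 => ->; apply: eq_mmap => l.
  by apply: natural_ext => // i; rewrite horner_line mul0r addr0.
move=> x Xx; have [v [y [c [c' [c0 c'0 cE yx]]]]] := lim x Xx.
have Phiv : mmap polyC (fun l => Phi _ v (enum_val l)) f = 0.
  apply: poly_vanish => s; rewrite -[LHS]/(horner_eval s _) mmap_comp.
  rewrite -[RHS](Phi0 (fun i => (v i).[s])) /mmap.
  apply: eq_bigr => m _; rewrite /= /horner_eval hornerC; congr (_ * _).
  by apply: mmap1_eq => l; rewrite /= /horner_eval natural_horner.
have : \prod_i c' i ^+ d i * mmap polyC (fun l => y (enum_val l)) f = 0.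
  rewrite -(mhomog_scale _ _ _ homf).
  rewrite -(eq_mmap _ (h := fun l => c (blk (enum_val l)) * Phi _ v (enum_val l))).
    by rewrite (mhomog_scale _ _ _ homf) Phiv mulr0.
  by move=> l; rewrite cE.
move/eqP; rewrite mulf_eq0 => /orP[|/eqP h].
  by rewrite prodf_seq_eq0 => /hasP[i _] /=; rewrite expf_eq0 (negPf (c'0 i)) andbF.
have := congr1 (horner_eval 0) h; rewrite mmap_comp /horner_eval horner0 => <-.
rewrite /meval /mmap; apply: eq_bigr => m _.
rewrite /= /horner_eval hornerC; congr (_ * _).
by apply: mmap1_eq => l; rewrite /= /horner_eval yx.
Qed.

Lemma sub_dense (S : mspace) (X U U' : vec K S -> Prop) :
  dense X U -> (forall x, X x -> U x -> U' x) -> dense X U'.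
Proof.
move=> dU UU' d p hp p0; apply: (dU d p hp) => x Xx Ux; apply: p0 => //.
exact: UU'.
Qed.

Lemma eqpt_refl (S : mspace) (x : vec K S) : eqpt x x.
Proof. by exists (fun=> 1) => *; rewrite ?oner_neq0 ?mul1r. Qed.

Lemma eqpt_ext (S : mspace) (x y : vec K S) : x =1 y -> eqpt x y.
Proof. by move=> xy; exists (fun=> 1) => *; rewrite ?oner_neq0 ?mul1r. Qed.

Lemma eqpt_sym (S : mspace) (x y : vec K S) : eqpt x y -> eqpt y x.
Proof.
move=> [c c0 cE]; exists (fun i => (c i)^-1) => [i|j]; first by rewrite invr_eq0.
by rewrite cE mulKf.
Qed.

Lemma eqpt_trans (S : mspace) (y x z : vec K S) :
  eqpt x y -> eqpt y z -> eqpt x z.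
Proof.
move=> [c c0 cE] [d d0 dE]; exists (fun i => d i * c i) => [i|j].
  by rewrite mulf_neq0.
by rewrite dE cE mulrA.
Qed.

Lemma eqpt_is_pt (S : mspace) (x y : vec K S) : eqpt x y -> is_pt x -> is_pt y.
Proof.
move=> [c c0 cE] xpt i; have [j ji xj] := xpt i.
by exists j; rewrite // cE mulf_neq0.
Qed.

Lemma eqpt_nm (S T : mspace) (F : natmap S T) (x y : vec K S) :
  eqpt x y -> eqpt (F K x) (F K y).
Proof.
move=> [c c0 cE]; exists (fun t => \prod_i c i ^+ nm_deg F t i) => [t|j].
  by rewrite prodf_seq_neq0; apply/allP => i _; rewrite expf_neq0.
by rewrite (nm_ext F cE) nm_graded.
Qed.

End Generic.

(** * Smoothing a stable curve *)

Definition dt (R : comNzRingType) (a b : 'I_2 -> R) : R :=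
  a 0 * b 1 - a 1 * b 0.

Definition br (R : comNzRingType) (P : Type) (u : P * 'I_2 -> R) (s t : P) : R :=
  dt (fun c => u (s, c)) (fun c => u (t, c)).

(** * The tree of components of a stable curve *)

Section Tree.

Variables (K : closedFieldType) (n : nat) (C : stable_curve K n).

Let V := comp C.
Let e : rel V := @adj K n C.

(** For adjacent [v] and [w], the part of the tree seen from [v] through [w]; the relation is the
    one used in [towards]. *)
Definition branch (v w : V) : pred V :=
  connect [rel a b | [&& e a b, a != v & b != v]] w.

Let cut (v w : V) : rel V :=
  [rel a b | e a b && ~~ ((a == v) && (b == w) || (a == w) && (b == v))].

Let cut_sym v w : connect_sym (cut v w).
Proof.
apply: sym_connect_sym => a b; rewrite /cut /= /e adj_sym; congr (_ && ~~ _).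
by rewrite orbC andbC [X in _ || X]andbC.
Qed.

Lemma adj_neq v w : e v w -> w != v.
Proof. by move=> vw; apply/eqP => wv; move: vw; rewrite wv /e adj_irr. Qed.

(** A simple path from [w] to [v] avoiding the edge between them would close up with it to a cycle.
    [branch_disjoint] and [branch_inj] both produce such a path. *)
Let cut_bridge v w : e v w -> ~~ connect (cut v w) w v.
Proof.
move=> vw; apply/negP => /connectP[p0 wp0 vE].
case/shortenP: wp0 vE => p wp up _ vE.
apply: (@curve_acyclic K n C (w :: p)) => //.
  case: p wp up vE => [|y [|//]] //=.
    by move=> _ _ vw'; rewrite vw' /e adj_irr in vw.
  by rewrite /cut /= => /andP[/andP[_ h] _] _ vy; rewrite vy !eqxx orbT in h.
rewrite /ucycle up andbT /= rcons_path -vE [adj _ _]vw andbT.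
by apply: sub_path wp => a b /andP[].
Qed.

Let branch_cut v w w' x : branch v w' x -> connect (cut v w) w' x.
Proof.
apply: connect_sub => a b /and3P[ab av bv]; apply: connect1.
by rewrite /cut /= ab (negPf av) (negPf bv) andbF.
Qed.

Lemma branch_disjoint v w x : e v w -> branch v w x -> branch w v x -> False.
Proof.
move=> vw bv bw; move/negP: (cut_bridge vw); apply.
apply: connect_trans (branch_cut _ bv) _.
rewrite cut_sym; apply: connect_sub (branch_cut v bw) => a b ab.
by apply: connect1; move: ab; rewrite /cut /= orbC.
Qed.

Lemma branch_inj v w w' x :
  e v w -> e v w' -> branch v w x -> branch v w' x -> w = w'.
Proof.
move=> vw vw' bw bw'; apply/eqP/negPn/negP => ww'.
move/negP: (cut_bridge vw); apply.
apply: connect_trans (branch_cut _ bw) _.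
apply: (@connect_trans _ _ w'); first by rewrite cut_sym; apply: branch_cut bw'.
apply: connect1; rewrite /cut /= /e adj_sym [adj _ _]vw' /= (negPf (adj_neq vw')).
by rewrite [w' == w]eq_sym (negPf ww').
Qed.

Lemma branch_neq v w x : e v w -> branch v w x -> x != v.
Proof.
move=> vw /connectP[p wp ->] {x}.
elim: p w vw wp => [|y p IHp] w vw /=; first by rewrite adj_neq.
case/andP=> /and3P[_ _ yv] yp; elim: p y yv yp {IHp} => //= z p IHp y yv.
by case/andP=> /and3P[_ _ zv]; apply: IHp.
Qed.

Lemma branch_cover v w x : e v w -> branch v w x || branch w v x.
Proof.
move=> vw; have : connect e v x by apply: curve_connected.
case/connectP=> p vp ->; elim/last_ind: p vp => [|p y IHp] /=.
  by rewrite /branch connect0 orbT.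
rewrite rcons_path last_rcons => /andP[/IHp {}IHp yz].
move: (last v p) IHp yz => z; have [-> _ _|yv] := eqVneq y v.
  by rewrite /branch connect0 orbT.
have [-> _ _|yw] := eqVneq y w; first by rewrite /branch connect0.
have wv : e w v by rewrite /e adj_sym.
case/orP=> bz zy; apply/orP; [left|right]; apply: connect_trans (bz) _;
  by apply: connect1; rewrite /= zy ?yv ?yw (branch_neq _ bz).
Qed.

Section Target.

Variable x : V.

Let walk (v : V) (k : nat) :=
  [exists p : k.-tuple V, path e v p && (last v p == x)].

Let walk_ex v : exists k, walk v k.
Proof.
have /connectP[p vp xE] : connect e v x by apply: curve_connected.
by exists (size p); apply/existsP; exists (in_tuple p); rewrite /= vp -xE /=.
Qed.

Let dist v := ex_minn (walk_ex v).

Let walkP v (p : seq V) : path e v p -> last v p = x -> (dist v <= size p)%N.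
Proof.
move=> vp px; rewrite /dist; case: ex_minnP => k _; apply.
by apply/existsP; exists (in_tuple p); rewrite /= vp px /=.
Qed.

(** Take the first step of a shortest walk to [x]. The rest never returns to [v], since the walk
    could then be shortened, so it stays in one branch. *)
Lemma next_ex v : v != x ->
  exists w, [/\ e v w, dist v = (dist w).+1 & branch v w x].
Proof.
move=> vx; have [p [vp px szp]] :
    exists p, [/\ path e v p, last v p = x & size p = dist v].
  rewrite /dist; case: ex_minnP => k /existsP[p /andP[vp /eqP px]] _.
  by exists p; rewrite vp px size_tuple.
case: p vp px szp => [_ /= vx'|w p /=]; first by rewrite vx' eqxx in vx.
case/andP=> vw wp px szp; exists w; split=> //.
  apply/eqP; rewrite eqn_leq -{2}szp ltnS walkP // andbT.
  have [q [wq qx <-]] : exists q, [/\ path e w q, last w q = x & size q = dist w].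
    rewrite /dist; case: ex_minnP => k /existsP[q /andP[wq /eqP qx]] _.
    by exists q; rewrite wq qx size_tuple.
  by apply: (walkP (p := w :: q)); rewrite //= vw.
have vp : v \notin w :: p.
  apply/negP; rewrite inE eq_sym (negPf (adj_neq vw)) /= => vp.
  case/splitPr: vp wp px szp => p1 p2; rewrite cat_path last_cat /=.
  case/and3P=> _ _ vp2 px szp; have := walkP vp2 px.
  by rewrite -szp size_cat /= addnS ltnNge leqW ?leq_addl.
apply/connectP; exists p => //; move: vp wp => /=; rewrite inE negb_or => /andP[].
elim: p {px szp} w {vw} => //= y p IHp w vw; rewrite inE negb_or => /andP[vy vp].
case/andP=> wy yp; rewrite wy /= eq_sym vw [y == v]eq_sym vy /=.
exact: IHp.
Qed.

Lemma tree_ind (Q : V -> Prop) :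
  Q x -> (forall v w, e v w -> branch v w x -> Q w -> Q v) -> forall v, Q v.
Proof.
move=> Qx Qs v; have [k] := ubnP (dist v); elim: k v => // k IHk v.
have [->//|/next_ex[w [vw -> vwx]] h] := eqVneq v x.
by apply: Qs vw vwx _; apply: IHk.
Qed.

(** By [branch_inj] the neighbour towards [x] is unique, so data at [x] can be transported outwards
    without choices. With [glue] as the step this gives the functions [zeta]. *)
Lemma tree_rec (T : Type) (t0 : T) (step : V -> V -> T -> T) :
  exists z : V -> T, z x = t0 /\
    forall v w, e v w -> branch v w x -> z v = step v w (z w).
Proof.
pose nx v := odflt v [pick w | e v w && branch v w x].
pose f := fix f k v := if k is k'.+1 then step v (nx v) (f k' (nx v)) else t0.
exists (fun v => f (dist v) v); split=> [|v w vw vwx].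
  by have := walkP (v := x) (p := [::]) isT erefl; rewrite leqn0 => /eqP ->.
have vx : v != x by rewrite eq_sym (branch_neq vw vwx).
have [w' [vw' dE vwx']] := next_ex vx.
have nxE : nx v = w.
  rewrite /nx; case: pickP => [y /andP[vy vyx]|/(_ w)]; last by rewrite vw vwx.
  exact: branch_inj vwx.
by rewrite dE /= nxE (branch_inj vw vw' vwx vwx').
Qed.

End Target.

End Tree.

Definition compl2 (K : fieldType) (a : 'I_2 -> K) : 'I_2 -> K := fun c =>
  if a 0 != 0 then (if c == 0 then 0 else (a 0)^-1)
  else (if c == 0 then - (a 1)^-1 else 0).

Lemma dt_compl2 (K : fieldType) (a : 'I_2 -> K) c :
  a c != 0 -> dt a (compl2 a) = 1.
Proof.
rewrite /dt /compl2 /=; have [a0|a0 _] := eqVneq (a 0) 0; last first.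
  by rewrite mulr0 subr0 mulfV.
have [->|c1] : c = 0 \/ c = 1 by case: c => [[|[|//]] h]; [left|right]; apply: val_inj.
  by rewrite a0 eqxx.
by move=> a1; rewrite mulr0 sub0r mulrN opprK mulfV // -c1.
Qed.

(** * Gluing components with a parameter *)

Section Smoothing.

Variables (K : closedFieldType) (n : nat) (C : stable_curve K n).

Let V := comp C.
Let e : rel V := @adj K n C.

Definition node (v w : V) : 'I_2 -> K := fun c => pos v (inl w) 0 c.

(* The gluing of [w] to [v] along their node: it degenerates at ['X = 0] to a
   map that sends all of [w] except the node to the node of [v]. *)
Definition glue (v w : V) (u : 'I_2 -> {poly K}) : 'I_2 -> {poly K} := fun c =>
  dt (fun a => (node w v a)%:P) u * (node v w c)%:P
  + 'X * dt (fun a => (compl2 (node w v) a)%:P) u * (compl2 (node v w) c)%:P.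

Lemma dt_node v w : e v w -> dt (node v w) (compl2 (node v w)) = 1.
Proof.
move=> vw; have vs : inl w \in special e (@mark K n C) v by [].
have : (1 < #|special e (@mark K n C) v|)%N by apply: ltnW; apply: curve_stable.
case/card_gt1P=> s [t [sv tv st]].
have [u uv wu] : exists2 u, u \in special e (@mark K n C) v & inl w != u.
  by have [ws|] := eqVneq (inl w) s; [exists t; rewrite // ws|exists s].
have := curve_pos vs uv wu; rewrite /det2.
have [n0|n0 _] := eqVneq (pos v (inl w) 0 0) 0; last exact: dt_compl2 n0.
have [n1|n1 _] := eqVneq (pos v (inl w) 0 1) 0; last exact: dt_compl2 n1.
by rewrite n0 n1 !mul0r subrr eqxx.
Qed.

Let dtC (a b : 'I_2 -> K) : dt (fun c => (a c)%:P) (fun c => (b c)%:P) = (dt a b)%:P.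
Proof. by rewrite /dt polyCB !polyCM. Qed.

(** In the unimodular bases formed by a node and its [compl2], [glue v w] sends [node w v] to [- 'X]
    times [compl2 (node v w)], and [compl2 (node w v)] to [node v w]. This is the smoothing xy = -t
    of the node; both this lemma and the determinant ['X] of [dt_glue] can be read off. *)
Lemma glueK v w u c : e v w -> glue v w (glue w v u) c = - 'X * u c.
Proof.
move=> vw; have wv : e w v by rewrite /e adj_sym.
have := dtC (node v w) (compl2 (node v w)).
have := dtC (node w v) (compl2 (node w v)).
rewrite !dt_node // polyC1 /glue.
move: (node v w) (node w v) (compl2 (node v w)) (compl2 (node w v)) => x y a b.
rewrite /dt /= => h1 h2.
have [->|->] : c = 0 \/ c = 1
  by case: c => [[|[|//]] h]; [left|right]; apply: val_inj.
  transitivity (- 'X * u 0 * (((y 0)%:P * (b 1)%:P - (y 1)%:P * (b 0)%:P)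
    * ((x 0)%:P * (a 1)%:P - (x 1)%:P * (a 0)%:P))); first by ring.
  by rewrite h1 h2 !mulr1.
transitivity (- 'X * u 1 * (((y 0)%:P * (b 1)%:P - (y 1)%:P * (b 0)%:P)
  * ((x 0)%:P * (a 1)%:P - (x 1)%:P * (a 0)%:P))); first by ring.
by rewrite h1 h2 !mulr1.
Qed.

Lemma dt_glue v w u u' : e v w -> dt (glue v w u) (glue v w u') = 'X * dt u u'.
Proof.
move=> vw; have wv : e w v by rewrite /e adj_sym.
have := dtC (node v w) (compl2 (node v w)).
have := dtC (node w v) (compl2 (node w v)).
rewrite !dt_node // polyC1 /glue.
move: (node v w) (node w v) (compl2 (node v w)) (compl2 (node w v)) => x y a b.
rewrite /dt /= => h1 h2.
transitivity ('X * (u 0 * u' 1 - u 1 * u' 0)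
    * (((y 0)%:P * (b 1)%:P - (y 1)%:P * (b 0)%:P)
    * ((x 0)%:P * (a 1)%:P - (x 1)%:P * (a 0)%:P))); first by ring.
by rewrite h1 h2 !mulr1.
Qed.

Lemma towards_ex v i : exists s, @towards K n C v i s.
Proof.
have [->|vi] := eqVneq v (mark C i); first by exists (inr i); rewrite /= !eqxx.
have [w [vw _ h]] := next_ex vi.
by exists (inl w); rewrite /= [adj _ _]vw.
Qed.

Lemma towards_special v i s :
  @towards K n C v i s -> s \in special (@adj K n C) (@mark K n C) v.
Proof. by case: s => [w|j] /= /andP[]// /eqP ->. Qed.

Lemma towards_inj v i s t : @towards K n C v i s -> @towards K n C v i t -> s = t.
Proof.
case: s t => [w|j] [w'|j'] //= /andP[h1 h2] /andP[h3 h4].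
- by rewrite (branch_inj h1 h3 h2 h4).
- by move: (branch_neq h1 h2); rewrite (eqP h4) eqxx.
- by move: (branch_neq h3 h4); rewrite (eqP h2) eqxx.
- by rewrite (eqP h1) (eqP h3).
Qed.

(** [zeta i v] is the i-th point of the smoothed curve in the chart of the component [v]: constant
    on its own component, and glued outwards from there. *)
Variable zeta : 'I_n -> V -> 'I_2 -> {poly K}.
Hypothesis zeta_mark : forall i c,
  zeta i (mark C i) c = (pos (mark C i) (inr i) 0 c)%:P.
Hypothesis zeta_glue : forall i v w, e v w -> branch v w (mark C i) ->
  zeta i v = glue v w (zeta i w).

(** At ['X = 0] the chart of [v] sees a point at the special point leading to it. The factor [r]
    stays nonzero because, on the next component, the special point towards [i] is not the node
    leading back to [v]. *)
Lemma zeta_limit i v s : @towards K n C v i s ->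
  exists2 r : K, r != 0 & forall c, (zeta i v c).[0] = r * pos v s 0 c.
Proof.
move: v s; apply: (@tree_ind K n C (mark C i)) => [s hs|v w vw vwi IHw s hs].
  exists 1; rewrite ?oner_neq0 // => c; rewrite zeta_mark hornerC mul1r.
  by rewrite -(@towards_inj (mark C i) i (inr i) s) //= !eqxx.
have sE : s = inl w by apply: towards_inj hs _; rewrite /= [adj _ _]vw.
have [s' hs'] := towards_ex w i; have [r r0 zE] := IHw _ hs'.
have wv : e w v by rewrite /e adj_sym.
exists (r * det2 (pos w (inl v)) (pos w s')) => [|c].
  rewrite mulf_neq0 //; apply: curve_pos; rewrite ?(towards_special hs') //.
  apply/eqP => sv; move: hs'; rewrite -sv /= => /andP[_ h].
  exact: branch_disjoint vw vwi h.
rewrite (zeta_glue vw vwi) /glue /dt !hornerE !zE sE /det2 /node.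
by ring.
Qed.

(** The change of chart from [w] to [v] gives [zeta i v] exactly when the point lies beyond [w];
    otherwise it glues back and forth, which costs [- 'X] by [glueK]. *)
Definition shift v w i : {poly K} := if branch v w (mark C i) then 1 else - 'X.

Lemma shift_neq0 v w i : shift v w i != 0.
Proof. by rewrite /shift; case: ifP; rewrite ?oppr_eq0 ?polyX_eq0 ?oner_neq0. Qed.

Lemma zeta_shift v w i c : e v w ->
  shift v w i * zeta i v c = glue v w (zeta i w) c.
Proof.
move=> vw; rewrite /shift; case: ifP => vwi.
  by rewrite mul1r (zeta_glue vw vwi).
have wv : e w v by rewrite /e adj_sym.
have wvi : branch w v (mark C i).
  by have := branch_cover (mark C i) vw; rewrite vwi.
by rewrite (zeta_glue wv wvi) glueK.
Qed.

Lemma dt_zeta_shift v w i j : e v w ->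
  shift v w i * shift v w j * dt (zeta i v) (zeta j v)
  = 'X * dt (zeta i w) (zeta j w).
Proof.
move=> vw; rewrite -(dt_glue _ _ vw) {2}/dt -!zeta_shift // /dt.
by ring.
Qed.

Lemma dt_zeta_rel v w : exists (a : 'I_n -> {poly K}) (d : {poly K}),
  [/\ forall i, a i != 0, d != 0 & forall i j,
    a i * a j * dt (zeta i v) (zeta j v) = d * dt (zeta i w) (zeta j w)].
Proof.
have /connectP[p vp ->] : connect e v w by apply: curve_connected.
elim/last_ind: p vp => [|p y IHp] /=.
  by exists (fun=> 1), 1; split=> [i||i j]; rewrite ?oner_neq0 // !mulr1.
rewrite rcons_path last_rcons => /andP[/IHp[a [d [a0 d0 aE]]] zy].
exists (fun i => a i * shift (last v p) y i), (d * 'X); split=> [i||i j].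
- by rewrite mulf_neq0 ?shift_neq0.
- by rewrite mulf_neq0 ?polyX_eq0.
rewrite -[RHS]mulrA -(dt_zeta_shift _ _ zy) [RHS]mulrCA -aE.
by ring.
Qed.

(** By [dt_zeta_rel] it is enough to look from the component of [i], where even the limits are
    distinct special points. *)
Lemma dt_zeta_neq0 v i j : i != j -> dt (zeta i v) (zeta j v) != 0.
Proof.
move=> ij; set w := mark C i.
have [a [d [a0 d0 aE]]] := dt_zeta_rel w v.
suff h : dt (zeta i w) (zeta j w) != 0.
  apply/eqP => h'; move/eqP: (aE i j); rewrite h' mulr0 !mulf_eq0.
  by rewrite (negPf (a0 i)) (negPf (a0 j)) (negPf h).
have [s hs] := towards_ex w j; have [r r0 zE] := zeta_limit hs.
have ws : @towards K n C w i (inr i) by rewrite /= /w !eqxx.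
have is' : inr i != s.
  apply/eqP => is'; move: hs; rewrite -is' /= => /andP[/eqP ij' _].
  by rewrite ij' eqxx in ij.
have := curve_pos (towards_special ws) (towards_special hs) is'.
apply: contra => /eqP /(congr1 (horner_eval 0)); rewrite /horner_eval /dt.
rewrite !hornerE !zE !zeta_mark !hornerC -/w => h.
apply/eqP; apply: (mulfI r0); rewrite mulr0 -h /det2.
by ring.
Qed.

End Smoothing.

Definition confsp (P : finType) : mspace := @MSpace P (P * 'I_2)%type fst.

(** The function [b] is arbitrary so that brackets of vectors, of polynomial families and of
    permuted points are all covered. *)
Definition crq (n : nat) (R : comNzRingType) (b : 'I_n -> 'I_n -> R)
    (q : quad n) (c : 'I_2) : R :=
  if c == 0 then b (val q 0) (val q 2) * b (val q 1) (val q 3)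
  else b (val q 0) (val q 3) * b (val q 1) (val q 2).

Lemma quad_neq (n : nat) (q : quad n) a b : a != b -> val q a != val q b.
Proof. by apply: contra => /eqP /(injectiveP _ (valP q)) ->. Qed.

Lemma ord2_ind (P : 'I_2 -> Prop) : P 0 -> P 1 -> forall c, P c.
Proof.
move=> P0 P1 [[|[|//]] h]; [have -> : Ordinal h = 0|have -> : Ordinal h = 1] => //;
  exact: val_inj.
Qed.

Lemma dt_colinear (K : fieldType) (x y : 'I_2 -> K) :
  dt x y = 0 -> (exists c, x c != 0) -> (exists c, y c != 0) ->
  exists2 r, r != 0 & forall c, y c = r * x c.
Proof.
rewrite /dt => /eqP; rewrite subr_eq0 => /eqP h [c xc] [c' yc'].
have yE b : y b = y c / x c * x b.
  have hb : y b * x c = y c * x b.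
    elim/ord2_ind: b; elim/ord2_ind: c {xc} => //.
      by rewrite mulrC -h mulrC.
    by rewrite mulrC h mulrC.
  by rewrite mulrAC -hb mulfK.
exists (y c / x c) => //; apply: contra yc' => /eqP h'.
by rewrite yE h' mul0r.
Qed.

Lemma prod_ord4 (R : comNzRingType) (f : 'I_4 -> R) :
  \prod_a f a = f 0 * f 1 * f 2 * f 3.
Proof.
rewrite 3!big_ord_recl big_ord1 !mulrA; congr (f _ * f _ * f _ * f _);
  exact: val_inj.
Qed.

(** * Limits of cross-ratios *)

Section Median.

Variables (K : closedFieldType) (n : nat) (C : stable_curve K n).
Variable zeta : 'I_n -> comp C -> 'I_2 -> {poly K}.
Hypothesis zeta_mark : forall i c,
  zeta i (mark C i) c = (pos (mark C i) (inr i) 0 c)%:P.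
Hypothesis zeta_glue : forall i v w, adj v w -> branch v w (mark C i) ->
  zeta i v = glue v w (zeta i w).

Variables (v0 : comp C) (q : quad n).

Let dz v i j := dt (zeta i v) (zeta j v).
Let D v := crq (dz v) q 0.

Let dz_neq0 v i j : i != j -> dz v i j != 0.
Proof. exact: dt_zeta_neq0. Qed.

(* Moving from a component to a neighbour towards which three of the four
   points lie divides the first coordinate of the cross-ratio by ['X] or its
   square. *)
Lemma median_ex : exists v, forall w (a b c : 'I_4), adj v w ->
  a != b -> b != c -> a != c ->
  branch v w (mark C (val q a)) -> branch v w (mark C (val q b)) ->
  branch v w (mark C (val q c)) -> False.
Proof.
case: (@arg_minnP _ v0 predT (fun v => size (D v))) => // v _ vmin.
exists v => w a b c vw ab bc ac ba bb bc'.
pose sh d := shift v w (val q d).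
have D_neq0 u : D u != 0 by rewrite /D /crq /= mulf_neq0 ?dz_neq0 ?quad_neq.
have DE : \prod_d sh d * D v = D w * 'X^2.
  rewrite prod_ord4 /D /crq /=.
  rewrite /sh expr2 [RHS]mulrC [RHS]mulrACA /dz -!(dt_zeta_shift zeta_glue _ _ vw).
  by ring.
(* At most one of the four shifts is [- 'X], against ['X^2] on the other side of [DE]: passing to
   [w] would lower the degree of [D], contrary to the choice of [v]. *)
have shE : (size (\prod_d sh d)%R <= 2)%N.
  rewrite (bigD1 a) //= (bigD1 b) /=; last by rewrite eq_sym.
  rewrite (bigD1 c) /=; last by rewrite eq_sym ac eq_sym bc.
  rewrite /sh {1 2 3}/shift ba bb bc' !mul1r.
  have [d dP|no] := pickP (fun d => (d != a) && (d != b) && (d != c)).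
    rewrite (bigD1 d) //= big1 ?mulr1.
      by rewrite /shift; case: ifP; rewrite ?size_polyN ?size_polyX ?size_poly1.
    move=> d' /andP[/andP[/andP[d'a d'b] d'c] d'd]; exfalso.
    suff : (4 < #|{:'I_4}|)%N by rewrite card_ord.
    apply: leq_trans (max_card (mem [:: a; b; c; d; d'])).
    move: dP => /andP[/andP[da db] dc].
    have /card_uniqP -> // : uniq [:: a; b; c; d; d'].
    rewrite /= !inE !negb_or ab ac bc [a == _]eq_sym da [a == _]eq_sym d'a.
    by rewrite ![b == _]eq_sym db d'b ![c == _]eq_sym dc d'c [d == _]eq_sym d'd.
  by rewrite big1 ?size_poly1 // => d dP; move: (no d); rewrite dP.
have := vmin w isT; rewrite leqNgt => /negP; apply.
have := congr1 (fun p : {poly K} => size p) DE; rewrite [RHS]size_mulXn //= => sE.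
have sh0 : \prod_d sh d != 0.
  by rewrite prodf_seq_neq0; apply/allP => d _; apply: shift_neq0.
rewrite -ltnS -[X in (X <= _)%N]/(2 + size (D w))%N -sE size_mul //.
rewrite -ltnS prednK ?addn_gt0 ?size_poly_gt0 ?D_neq0 ?orbT //.
by rewrite addnC -(addn2 (size (D v))) leq_add2l.
Qed.

(** From the component [v] of [median_ex] no three of the four points coincide, so the limit of the
    cross-ratio there is a genuine point of P^1, proportional to [x] by hypothesis; [dt_zeta_rel]
    carries this over to the fixed chart [v0]. *)
Lemma crq_limit (x : 'I_2 -> K) :
  (exists c, x c != 0) ->
  (forall v (s : 'I_4 -> comp C + 'I_n),
    (forall a, towards v (val q a) (s a)) ->
    det2 (\row_c x c) (cross_ratio (fun a => pos v (s a))) = 0) ->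
  exists u : {poly K} * {poly K} * ('I_2 -> {poly K}),
    [/\ u.1.1 != 0, u.1.2 != 0, forall c, u.1.1 * crq (dz v0) q c = u.1.2 * u.2 c
      & forall c, (u.2 c).[0] = x c].
Proof.
move=> x0 xC; have [v vmed] := median_ex.
have [s hs] := fin_all_exists (fun a => towards_ex v (val q a)).
have /fin_all_exists2[r r0 rE] : forall a, exists2 r, r != 0 &
    forall c, (zeta (val q a) v c).[0] = r * pos v (s a) 0 c.
  by move=> a; apply: zeta_limit (hs a).
have same a b : a != b -> det2 (pos v (s a)) (pos v (s b)) == 0 ->
    exists2 w, adj v w & s a = inl w /\ s b = inl w.
  move=> ab; have [sab _|sab h] := eqVneq (s a) (s b); last first.
    have := curve_pos (towards_special (hs a)) (towards_special (hs b)) sab.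
    by rewrite h.
  move: (hs a) (hs b); rewrite sab; case: (s b) => [w|j] /=.
    by move=> /andP[vw _] _; exists w.
  move=> /andP[/eqP -> _] /andP[/eqP /(injectiveP _ (valP q)) ba _].
  by rewrite ba eqxx in ab.
have no3 a b c : a != b -> b != c -> a != c ->
    det2 (pos v (s a)) (pos v (s b)) == 0 ->
    det2 (pos v (s b)) (pos v (s c)) == 0 -> False.
  move=> ab bc ac /(same _ _ ab)[w vw [sa sb]] /(same _ _ bc)[w' _ [sb' sc]].
  have ww' : w' = w by move: sb'; rewrite sb => -[].
  rewrite ww' in sc; have := hs a; have := hs b; have := hs c.
  rewrite sa sb sc /= => /andP[_ hc] /andP[_ hb] /andP[_ ha].
  exact: (vmed w a b c).
have detC (a b : 'rV[K]_2) : (det2 a b == 0) = (det2 b a == 0).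
  by rewrite -oppr_eq0; congr (_ == _); rewrite /det2; ring.
pose cr c := cross_ratio (fun a => pos v (s a)) 0 c.
have cr0 : exists c, cr c != 0.
  case: (eqVneq (cr 0) 0) => [c0|]; last by exists 0.
  case: (eqVneq (cr 1) 0) => [c1|]; last by exists 1.
  (* If both coordinates vanish, two of the points coincide for each of them, and the two pairs
     share a point: three points would coincide. *)
  exfalso; move/eqP: c0; move/eqP: c1; rewrite /cr !mxE /= !mulf_eq0.
  case/orP=> h1 /orP[] h2.
  - by apply: (no3 3 0 2); rewrite // detC.
  - by apply: (no3 0 3 1); rewrite // detC.
  - by apply: (no3 0 2 1); rewrite // detC.
  - by apply: (no3 2 1 3); rewrite // detC.
have [r' r'0 crE] : exists2 r', r' != 0 & forall c, cr c = r' * x c.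
  apply: dt_colinear => //; have := xC v s hs.
  by rewrite /det2 /dt /cr !mxE.
have [a [d [a0 d0 aE]]] := dt_zeta_rel zeta_glue v0 v.
(* The limit of [crq (dz v) q] is [m] times [x]: the [r b] come from the limits of the four points,
   and [r'] from comparing the cross-ratio with [x]. *)
pose m := \prod_b r b * r'.
have m0 : m != 0.
  by rewrite mulf_neq0 // prodf_seq_neq0; apply/allP => b _; apply: r0.
exists (\prod_b a (val q b), d ^+ 2 * m%:P, fun c => m^-1%:P * crq (dz v) q c).
split=> /= [|||c].
- by rewrite prodf_seq_neq0; apply/allP => b _; apply: a0.
- by rewrite mulf_neq0 ?expf_neq0 // polyC_eq0.
- move=> c; rewrite mulrA -[d ^+ 2 * _ * _]mulrA -polyCM mulfV // mulr1.
  rewrite prod_ord4 expr2 /crq /dz.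
  have aux i j i' j' : a i * a j * (a i' * a j') * (dt (zeta i v0) (zeta j v0)
      * dt (zeta i' v0) (zeta j' v0))
    = d * d * (dt (zeta i v) (zeta j v) * dt (zeta i' v) (zeta j' v)).
    by rewrite mulrACA [RHS]mulrACA !aE.
  by case: ifP => _; rewrite -aux; ring.
have xE : x c = m^-1 * (\prod_b r b * cr c).
  by rewrite crE [_ * (r' * _)]mulrA mulrA mulVf // mul1r.
rewrite hornerM hornerC xE; congr (_ * _).
rewrite prod_ord4 /crq /cr /cross_ratio mxE /dz /dt.
by case: ifP => _; rewrite !(hornerM, hornerD, hornerN) !rE /det2; ring.
Qed.

End Median.

Definition cr_nat (n : nat) (R : comNzRingType) (u : 'I_n * 'I_2 -> R)
    (j : quad n * 'I_2) : R :=
  crq (br u) j.1 j.2.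

(** All points are read in the chart of one component, so that a single family [u] serves every
    quadruple; only the multipliers [c] and [c'] depend on the quadruple. This is the form that
    [dense_param] asks for. *)
Lemma Mbar_limit (K : closedFieldType) (n : nat) (x : vec K (crsp n)) :
  (0 < n)%N -> Mbar x ->
  exists (u : 'I_n * 'I_2 -> {poly K}) (y : quad n * 'I_2 -> {poly K})
      (c c' : quad n -> {poly K}),
    [/\ forall i j, i != j -> br u i j != 0,
        (forall q, c q != 0) /\ (forall q, c' q != 0),
        forall j, c j.1 * cr_nat u j = c' j.1 * y j
      & forall j, (y j).[0] = x j].
Proof.
move=> n0 [C [xpt xC]].
have [z zP] := fin_all_exists (fun i => tree_rec (mark C i)
  (fun c => (pos (mark C i) (inr i) 0 c)%:P) (@glue K n C)).
have z_mark i c : z i (mark C i) c = (pos (mark C i) (inr i) 0 c)%:P.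
  by rewrite (zP i).1.
have z_glue i v w : adj v w -> branch v w (mark C i) ->
    z i v = glue v w (z i w) by apply: (zP i).2.
pose v0 := mark C (Ordinal n0).
have x0 q : exists c, x (q, c) != 0.
  by have [[q' c] /= <- xj] := xpt q; exists c.
have [f fP] := fin_all_exists (fun q =>
  crq_limit z_mark z_glue v0 (x0 q) (xC q)).
exists (fun j => z j.1 v0 j.2), (fun j => (f j.1).2 j.2),
  (fun q => (f q).1.1), (fun q => (f q).1.2).
split=> [i j ij||[q c]|[q c]].
- exact: (dt_zeta_neq0 z_mark z_glue).
- by split=> q; case: (fP q).
- by case: (fP q) => _ _ /(_ c).
- by case: (fP q) => _ _ _ /(_ c).
Qed.

(** * Configurations and cross-ratios *)

Section Bracket.

Variables (R : comNzRingType) (P : Type).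
Implicit Types (u : P * 'I_2 -> R) (s t : P).

Lemma brxx u s : br u s s = 0.
Proof. by rewrite /br /dt mulrC subrr. Qed.

Lemma brC u s t : br u s t = - br u t s.
Proof. by rewrite /br /dt; ring. Qed.

Lemma br_scale (c : P -> R) u s t :
  br (fun l => c l.1 * u l) s t = c s * c t * br u s t.
Proof. by rewrite /br /dt /=; ring. Qed.

Lemma plucker u i j a c : br u i a * br u j c - br u j a * br u i c
  = br u i j * br u a c.
Proof. by rewrite /br /dt; ring. Qed.

End Bracket.

Lemma br_natural (P : Type) (R R' : comNzRingType) (f : {rmorphism R -> R'})
    (u : P * 'I_2 -> R) (u' : P * 'I_2 -> R') s t :
  (forall l, u' l = f (u l)) -> br u' s t = f (br u s t).
Proof. by move=> uu'; rewrite /br /dt !uu' rmorphB !rmorphM. Qed.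

Lemma crq_natural (n : nat) (R R' : comNzRingType) (f : {rmorphism R -> R'})
    (b : 'I_n -> 'I_n -> R) (b' : 'I_n -> 'I_n -> R') q e :
  (forall i j, b' i j = f (b i j)) -> crq b' q e = f (crq b q e).
Proof. by move=> bb'; rewrite /crq; case: ifP => _; rewrite !bb' rmorphM. Qed.

Lemma crq_scale (n : nat) (R : comNzRingType) (b b' : 'I_n -> 'I_n -> R)
    (d : R) (c : 'I_n -> R) q e :
  (forall i j, b' i j = d * c i * c j * b i j) ->
  crq b' q e = d ^+ 2 * \prod_a c (val q a) * crq b q e.
Proof.
by move=> bb'; rewrite /crq prod_ord4 expr2; case: ifP => _; rewrite !bb'; ring.
Qed.

Lemma eq_crq (n : nat) (R : comNzRingType) (b b' : 'I_n -> 'I_n -> R) q e :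
  (forall i j, b i j = b' i j) -> crq b q e = crq b' q e.
Proof. by move=> bb'; rewrite /crq !bb'. Qed.

Section CrossRatioMap.

Variable n : nat.

Lemma cr_natural : natural (@cr_nat n).
Proof.
by move=> R R' f u u' uu' j; apply: crq_natural => s t; apply: br_natural.
Qed.

Lemma cr_graded :
  @graded (confsp 'I_n) (crsp n) (@cr_nat n) (fun q s => \sum_a (val q a == s))%N.
Proof.
move=> R c u [q e] /=; rewrite prod_sum_eq.
have brE i j : br (fun l => c l.1 * u l) i j = 1 * c i * c j * br u i j.
  by rewrite br_scale mul1r.
by have := crq_scale q e brE; rewrite expr1n mul1r.
Qed.

Definition crm : natmap (confsp 'I_n) (crsp n) :=
  @NatMap (confsp 'I_n) (crsp n) _ _ cr_natural cr_graded.

End CrossRatioMap.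

Definition disc (P : finType) (R : comNzRingType) (u : P * 'I_2 -> R) : R :=
  \prod_s \prod_(t | t != s) br u s t.

Lemma disc_natural (P : finType) :
  natural (fun R (u : P * 'I_2 -> R) (j : 'I_1) => disc u).
Proof.
move=> R R' f u u' uu' _; rewrite rmorph_prod; apply: eq_bigr => s _.
by rewrite rmorph_prod; apply: eq_bigr => t _; apply: br_natural.
Qed.

Lemma disc_neq0P (P : finType) (R : idomainType) (u : P * 'I_2 -> R) :
  disc u != 0 <-> (forall s t, s != t -> br u s t != 0).
Proof.
rewrite /disc prodf_seq_neq0; split=> [/allP h s t st|h].
  have := h s (mem_index_enum _); rewrite prodf_seq_neq0 => /allP/(_ t).
  by rewrite mem_index_enum eq_sym st; apply.
apply/allP => s _ /=; rewrite prodf_seq_neq0; apply/allP => t _.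
by apply/implyP => ts; apply: h; rewrite eq_sym.
Qed.

Section Smooth.

Variables (K : closedFieldType).

Lemma distinct_ex (P : finType) : exists u : P * 'I_2 -> K, disc u != 0.
Proof.
pose F (st : P * P) : nfun (P * 'I_2) 'I_1 := fun R u _ => br u st.1 st.2.
have [||u hu] := @generic_point K (P * 'I_2)%type (P * P)%type
    (filter (fun st => st.1 != st.2) (enum {: P * P})) F.
- by move=> st R R' f x x' xx' j; apply: br_natural.
- move=> [s t]; rewrite mem_filter /= => /andP[st _].
  exists (fun l => if l.1 == s then (l.2 == 0)%:R else (l.2 == 1)%:R).
  rewrite /F /br /dt /= eqxx [t == s]eq_sym (negPf st) /=.
  by rewrite mulr1 mulr0 subr0 oner_neq0.
by exists u; apply/disc_neq0P => s t st; apply: (hu (s, t)); rewrite mem_filter mem_enum /= st.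
Qed.

Variable n : nat.

Lemma crq_neq0 (u : 'I_n * 'I_2 -> K) q e : disc u != 0 -> crq (br u) q e != 0.
Proof.
move/disc_neq0P => hu; rewrite /crq.
by case: ifP => _; rewrite mulf_neq0 ?hu ?quad_neq.
Qed.

Lemma is_pt_crm (u : vec K (confsp 'I_n)) : disc u != 0 -> is_pt (crm n K u).
Proof. by move=> hu q; exists (q, 0); rewrite //; apply: crq_neq0. Qed.

Section SmoothCurve.

Variables (u : 'I_n * 'I_2 -> K) (n3 : (3 <= n)%N) (hu : disc u != 0).

Let cpos (v : unit) (s : unit + 'I_n) : 'rV[K]_2 :=
  \row_c if s is inr i then u (i, c) else 0.

Let nadj : rel unit := fun _ _ => false.

Let cpos_neq v : {in special nadj (fun=> tt) v &,
  forall s t, s != t -> det2 (cpos v s) (cpos v t) != 0}.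
Proof.
move=> [w|i] [w'|j] //= _ _ ij; rewrite /det2 !mxE.
exact: (iffLR (disc_neq0P _) hu).
Qed.

Let cstable v : (3 <= #|special nadj (fun _ : 'I_n => tt) v|)%N.
Proof.
apply: leq_trans n3 _; rewrite -[n in (n <= _)%N]card_ord.
rewrite -(card_codom (f := @inr unit 'I_n)); last by move=> ? ? [].
apply: subset_leq_card; apply/subsetP => s /codomP[i ->].
by case: v.
Qed.

Definition smooth_curve : stable_curve K n.
Proof.
apply: (@StableCurve K n unit nadj (fun=> tt) cpos) => //.
- by case=> [] []; rewrite connect0.
- by case=> [|x [|y p]].
Defined.

Lemma Mbar_smooth (x : vec K (crsp n)) : eqpt (crm n K u) x -> Mbar x.
Proof.
move=> ux; exists smooth_curve; split=> [|q v s hs].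
  exact: eqpt_is_pt ux (is_pt_crm hu).
have sE a : s a = inr (val q a).
  by have := hs a; case: (s a) => //= j /andP[/eqP ->].
have [c _ cE] := ux; rewrite /det2 /cross_ratio !mxE /= !cE /= !sE.
by rewrite /cr_nat /crq /= /det2 !mxE /br /dt; ring.
Qed.

End SmoothCurve.

End Smooth.

Section Quads.

Variable n : nat.

Lemma quad_ex (t : 'I_4 -> 'I_n) : injective t ->
  exists q : quad n, forall a, val q a = t a.
Proof.
move=> t_inj; have h : injectiveb [ffun a => t a].
  by apply/injectiveP => a b; rewrite !ffunE => /t_inj.
by exists (exist (fun f : {ffun 'I_4 -> 'I_n} => injectiveb f) _ h) => a;
  rewrite /= ffunE.
Qed.

Lemma quad4_ex (i j k l : 'I_n) :
  [/\ i != j, i != k & i != l] -> [/\ j != k, j != l & k != l] ->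
  exists q : quad n,
    [/\ val q 0 = i, val q 1 = j, val q 2 = k & val q 3 = l].
Proof.
move=> [ij ik il] [jk jl kl].
have [|q qE] := @quad_ex (fun a => tnth [tuple i; j; k; l] a).
  apply/tuple_uniqP; rewrite /= !inE !negb_or.
  by rewrite ij ik il jk jl kl.
by exists q; split; rewrite qE.
Qed.

Lemma quad_inh : (4 <= n)%N -> exists q : quad n, True.
Proof.
move=> n4; have [|q _] := quad_ex (t := fun a => widen_ord n4 a); last by exists q.
by move=> a b /(congr1 val) ab; apply: val_inj.
Qed.

End Quads.

(** * Normalising three of the points *)

Section Normalize.

Variables (n : nat) (a b c : 'I_n).
Hypotheses (ab : a != b) (ac : a != c) (bc : b != c).
Variable qd : 'I_n -> quad n.
Hypothesis qdE : forall i, i != a -> i != b -> i != c ->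
  [/\ val (qd i) 0 = i, val (qd i) 1 = b, val (qd i) 2 = a & val (qd i) 3 = c].

(* The coordinate of the i-th point for which [a], [b], [c] are 0, 1 and the
   point at infinity. *)
Definition norm_nat (R : comNzRingType) (x : quad n * 'I_2 -> R)
    (j : 'I_n * 'I_2) : R :=
  if j.1 == a then (j.2 == 1)%:R else if j.1 == b then 1
  else if j.1 == c then (j.2 == 0)%:R else x (qd j.1, j.2).

Definition based (i : 'I_n) := [|| i == a, i == b | i == c].

Lemma norm_natural : natural norm_nat.
Proof.
move=> R R' f x x' xx' j; rewrite /norm_nat.
by do !case: ifP => _ //; rewrite ?rmorph_nat ?rmorph1 ?xx'.
Qed.

Lemma norm_graded : @graded (crsp n) (confsp 'I_n) norm_nat
  (fun i q => ~~ based i && (qd i == q)).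
Proof.
move=> R g x [i e] /=; rewrite /norm_nat /based /=.
have [_|ia] := eqVneq i a; first by rewrite big1 ?mul1r.
have [_|ib] := eqVneq i b; first by rewrite big1 ?mul1r.
have [_|ic] := eqVneq i c; first by rewrite big1 ?mul1r.
by rewrite /= prod_pred1.
Qed.

Definition normm : natmap (crsp n) (confsp 'I_n) :=
  @NatMap (crsp n) (confsp 'I_n) _ _ norm_natural norm_graded.

(** The points [U] are the images of [u] under the linear map that sends [a], [b], [c] to 0, 1 and
    infinity; its determinant is the product of three brackets. The ring is only a domain because
    the lemma is applied over K[X] as well as over [K], whence [h] and [h'] in place of
    quotients. *)
Lemma normm_sim (R : idomainType) (u : 'I_n * 'I_2 -> R)
    (x : quad n * 'I_2 -> R) (g g' : quad n -> R) :
  (forall i j, i != j -> br u i j != 0) ->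
  (forall q, g q != 0) -> (forall q, g' q != 0) ->
  (forall j, g j.1 * cr_nat u j = g' j.1 * x j) ->
  exists h h' : 'I_n -> R, [/\ forall i, h i != 0, forall i, h' i != 0
    & forall i j, h i * h j * br (norm_nat x) i j
        = h' i * h' j * (br u b c * br u b a * br u a c) * br u i j].
Proof.
move=> hu g0 g'0 ux.
pose U (l : 'I_n * 'I_2) : R := if l.2 == 0 then br u l.1 a * br u b c
  else br u l.1 c * br u b a.
pose h i : R := if i == a then br u a c * br u b a
  else if i == b then br u b a * br u b c
  else if i == c then br u c a * br u b c else g' (qd i).
pose h' i : R := if based i then 1 else g (qd i).
have ba : b != a by rewrite eq_sym.
have cb : c != b by rewrite eq_sym.
have ca : c != a by rewrite eq_sym.
have hE l : h l.1 * norm_nat x l = h' l.1 * U l.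
  case: l => i e; rewrite /h /h' /norm_nat /U /based /=.
  have [->|ia] := eqVneq i a.
    by elim/ord2_ind: e; rewrite /= ?brxx ?mulr0 ?mul0r ?mulr1 ?mul1r.
  have [->|ib] := eqVneq i b.
    by elim/ord2_ind: e; rewrite /= mulr1 mul1r // mulrC.
  have [->|ic] := eqVneq i c.
    by elim/ord2_ind: e; rewrite /= ?brxx ?mulr0 ?mul0r ?mulr1 ?mul1r.
  have [q0 q1 q2 q3] := qdE ia ib ic.
  rewrite -(ux (qd i, e)) /cr_nat /crq /= q0 q1 q2 q3.
  by [].
exists h, h'; split=> [i|i|i j].
- rewrite /h; case: ifP => [_|ia]; first by rewrite mulf_neq0 ?hu.
  case: ifP => [_|ib]; first by rewrite mulf_neq0 ?hu.
  by case: ifP => [_|ic]; rewrite ?g'0 // mulf_neq0 ?hu.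
- by rewrite /h'; case: ifP; rewrite ?oner_neq0.
rewrite -br_scale (br_natural (f := idfun) i j hE) /= br_scale -!mulrA.
by congr (_ * (_ * _)); rewrite /U /br /dt /=; ring.
Qed.

Section OverField.

Variables (K : closedFieldType).

(** The trace on brackets of a linear change of coordinates of determinant [d] combined with
    rescalings [g] of the vectors: projective equivalence. *)
Definition sim (P : Type) (p p' : P * 'I_2 -> K) := exists d (g : P -> K),
  [/\ d != 0, forall s, g s != 0
    & forall s t, br p' s t = d * g s * g t * br p s t].

Lemma norm_crm_sim (u : 'I_n * 'I_2 -> K) : disc u != 0 ->
  sim u (normm K (crm n K u)).
Proof.
move/disc_neq0P => hu.
have [||j|h [h' [h0 h'0 hE]]] := @normm_sim K u (crm n K u) (fun=> 1) (fun=> 1) hu.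
- by move=> q; apply: oner_neq0.
- by move=> q; apply: oner_neq0.
- by [].
exists (br u b c * br u b a * br u a c), (fun i => h' i / h i).
split=> [|i|i j].
- by rewrite !mulf_neq0 ?hu // eq_sym.
- by rewrite mulf_neq0 ?invr_eq0.
apply: (mulfI (h0 i)); apply: (mulfI (h0 j)).
rewrite mulrA [h j * h i]mulrC hE.
by field; rewrite h0 h0.
Qed.

(* The equations expressing all the cross-ratios through the normalised
   configuration hold on smooth curves, hence on all stable curves. *)
Lemma crm_norm_Mbar (x : vec K (crsp n)) : Mbar x ->
  disc (normm K x) != 0 -> eqpt x (crm n K (normm K x)).
Proof.
move=> Mx hd; have n0 : (0 < n)%N := leq_ltn_trans (leq0n _) (ltn_ord a).
have [u [y [g [g' [hu [g0 g'0] uy yx]]]]] := Mbar_limit n0 Mx.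
have [h [h' [h0 h'0 hE]]] := normm_sim hu g0 g'0 uy.
have rel q : dt (fun e => x (q, e)) (fun e => crm n K (normm K x) (q, e)) = 0.
  pose N := crq (br (norm_nat y)) q.
  have : dt (fun e => y (q, e)) N = 0.
    pose m := \prod_i h (val q i).
    pose d := br u b c * br u b a * br u a c.
    pose m' := d ^+ 2 * \prod_i h' (val q i).
    have mE e : m * N e = m' * crq (br u) q e.
      have := @crq_scale n _ (br (norm_nat y))
        (fun i j => 1 * h i * h j * br (norm_nat y) i j) 1 h q e
        (fun _ _ => erefl).
      rewrite expr1n mul1r => <-.
      rewrite -(@crq_scale n _ (br u) (fun i j => d * h' i * h' j * br u i j)) //.
      by apply: eq_crq => i j; rewrite mul1r hE /d; ring.
    have m0 : m != 0 by rewrite prodf_seq_neq0; apply/allP => i _; apply: h0.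
    apply: (mulfI (g'0 q)); apply: (mulfI m0); rewrite !mulr0.
    rewrite /dt mulrA.
    transitivity ((g' q * y (q, 0)) * (m * N 1) - (g' q * y (q, 1)) * (m * N 0)).
      by ring.
    rewrite -!(uy (q, _)) !mE /cr_nat /=; ring.
  (* Only now is ['X] set to 0: the factors [m] and [g' q], just cancelled over K[X], may vanish
     there. *)
  move/(congr1 (horner_eval 0)); rewrite /horner_eval horner0 => <-.
  have xE l : x l = horner_eval 0 (y l) by rewrite /horner_eval yx.
  have NE e : crm n K (normm K x) (q, e) = horner_eval 0 (N e).
    apply: crq_natural => i j; apply: br_natural => l.
    exact: (norm_natural (f := horner_eval 0)).
  by rewrite /dt !NE !xE /horner_eval hornerD hornerN !hornerM.
have /fin_all_exists2[r r0 rE] q : exists2 r, r != 0 &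
    forall e, crm n K (normm K x) (q, e) = r * x (q, e).
  apply: dt_colinear (rel q) _ _; last by exists 0; apply: crq_neq0.
  have [C [xpt _]] := Mx; have [[q' e] /= <- xq] := xpt q.
  by exists e.
by exists r => // -[q e]; rewrite rE.
Qed.

End OverField.
End Normalize.

(** * Points of the affine line up to affine maps *)

Section Sim.

Variables (K : closedFieldType) (P : finType).
Implicit Types p : P * 'I_2 -> K.

Lemma sim_trans p' p p'' : sim p p' -> sim p' p'' -> sim p p''.
Proof.
move=> [d [g [d0 g0 E]]] [d' [g' [d'0 g'0 E']]].
exists (d' * d), (fun s => g' s * g s).
split=> [|s|s t]; rewrite ?mulf_neq0 // E' E.
by ring.
Qed.

Lemma eqpt_sim (p p' : vec K (confsp P)) : eqpt p p' -> sim p p'.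
Proof.
move=> [g g0 E]; exists 1, g; split=> [||s t]; rewrite ?oner_neq0 //.
by rewrite (br_natural (f := idfun) s t E) /= br_scale mul1r.
Qed.

Lemma sim_disc p p' : sim p p' -> disc p != 0 -> disc p' != 0.
Proof.
move=> [d [g [d0 g0 E]]] /disc_neq0P h; apply/disc_neq0P => s t st.
by rewrite E !mulf_neq0 ?h.
Qed.

End Sim.

Lemma prod_unit (R : comNzRingType) (f : unit -> R) : \prod_i f i = f tt.
Proof. by rewrite (bigD1 tt) //= big1 ?mulr1 // => -[]. Qed.

Section AffineLine.

Variable m : nat.

Let pt : finType := option 'I_m.+2.

(* The coordinates [l+1 - 0] of the finite points, the point [None] being sent
   to infinity, without denominators. *)
Definition diff_nat (R : comNzRingType) (p : pt * 'I_2 -> R) (l : 'I_m.+1) : R :=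
  br p (Some (lift ord0 l)) (Some ord0)
  * \prod_(j | j != l) br p (Some (lift ord0 j)) None.

Lemma diff_natural : natural diff_nat.
Proof.
move=> R R' f p p' pp' l; rewrite /diff_nat rmorphM rmorph_prod.
by congr (_ * _); [|apply: eq_bigr => j _]; apply: br_natural.
Qed.

(** All coordinates scale alike: the first bracket supplies the factor of the point [lift ord0 l],
    and the product supplies those of the other points. *)
Lemma diff_scale (R : comNzRingType) (p p' : pt * 'I_2 -> R) d (g : pt -> R) l :
  (forall s t, br p' s t = d * g s * g t * br p s t) ->
  diff_nat p' l = d ^+ m.+1 * (g (Some ord0)
    * \prod_j g (Some (lift ord0 j)) * g None ^+ m) * diff_nat p l.
Proof.
move=> E; rewrite /diff_nat E; under eq_bigr => j _ do rewrite E.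
rewrite !big_split /= !prodr_const.
have -> : #|[pred j | j != l]| = m by rewrite cardC1 card_ord.
by rewrite exprS [\prod_j g _](bigD1 l) //=; ring.
Qed.

Definition diff_deg (_ : unit) (s : pt) : nat :=
  ((Some ord0 == s) + \sum_j (Some (lift ord0 j) == s) + (None == s) * m)%N.

Lemma diff_graded : @graded (confsp pt) (projsp m.+1) diff_nat diff_deg.
Proof.
move=> R g p l /=; rewrite (@diff_scale _ p _ 1 g) => [|s t]; last first.
  by rewrite br_scale mul1r.
rewrite expr1n mul1r; congr (_ * _).
under [RHS]eq_bigr => s _ do rewrite !exprD exprM.
by rewrite !big_split /= prodrXl !prod_pred1 prod_sum_eq.
Qed.

Definition diffm : natmap (confsp pt) (projsp m.+1) :=
  @NatMap (confsp pt) (projsp m.+1) _ _ diff_natural diff_graded.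

Definition full (R : comNzRingType) (y : 'I_m.+1 -> R) (i : 'I_m.+2) : R :=
  if unlift ord0 i is Some j then y j else 0.

(* The points [full y i] of the affine line, rescaled by [y ord0] to make
   their homogeneous coordinates linear in [y]; [None] is at infinity. *)
Definition points_nat (R : comNzRingType) (y : 'I_m.+1 -> R) (l : pt * 'I_2) : R :=
  if l.1 is Some i then (if l.2 == 0 then full y i else y ord0)
  else (if l.2 == 0 then y ord0 else 0).

Lemma full_natural : natural full.
Proof.
move=> R R' f y y' yy' i; rewrite /full.
by case: (unlift _ _) => [j|]; rewrite ?rmorph0.
Qed.

Lemma points_natural : natural points_nat.
Proof.
move=> R R' f y y' yy' [[i|] e]; rewrite /points_nat /=; case: ifP => _ //.
  by apply: full_natural.
by rewrite rmorph0.
Qed.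

Lemma points_graded :
  @graded (projsp m.+1) (confsp pt) points_nat (fun _ _ => 1%N).
Proof.
move=> R g y [s e] /=; rewrite prod_unit expr1 /points_nat /full /=.
case: s => [i|]; case: ifP => _ //; last by rewrite mulr0.
by case: (unlift _ _) => [j|]; rewrite ?mulr0.
Qed.

Definition pointsm : natmap (projsp m.+1) (confsp pt) :=
  @NatMap (projsp m.+1) (confsp pt) _ _ points_natural points_graded.

Lemma br_points (R : comNzRingType) (y : 'I_m.+1 -> R) i j :
  br (points_nat y) (Some i) (Some j) = y ord0 * (full y i - full y j).
Proof. by rewrite /br /dt /points_nat /=; ring. Qed.

Lemma br_points_infty (R : comNzRingType) (y : 'I_m.+1 -> R) i :
  br (points_nat y) (Some i) None = - y ord0 ^+ 2.
Proof. by rewrite /br /dt /points_nat /=; ring. Qed.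

Lemma full0 (R : comNzRingType) (y : 'I_m.+1 -> R) : full y ord0 = 0.
Proof. by rewrite /full unlift_none. Qed.

Lemma full_lift (R : comNzRingType) (y : 'I_m.+1 -> R) l :
  full y (lift ord0 l) = y l.
Proof. by rewrite /full liftK. Qed.

Lemma full_sum (R : comNzRingType) (y : 'I_m.+1 -> R) i :
  \sum_j y j * (lift ord0 j == i)%:R = full y i.
Proof.
rewrite /full; case: unliftP => [l ->|->].
  rewrite (bigD1 l) //= eqxx mulr1 big1 ?addr0 // => j jl.
  by rewrite (inj_eq lift_inj) (negPf jl) mulr0.
by rewrite big1 // => j _; rewrite mulr0.
Qed.

Section Field.

Variable K : closedFieldType.
Implicit Types (p : pt * 'I_2 -> K) (y : 'I_m.+1 -> K).

Lemma diff_sim p p' : sim p p' -> eqpt (diffm K p) (diffm K p').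
Proof.
move=> [d [g [d0 g0 E]]]; exists (fun=> d ^+ m.+1 * (g (Some ord0)
    * \prod_j g (Some (lift ord0 j)) * g None ^+ m)) => [_|l].
  rewrite !mulf_neq0 ?expf_neq0 //.
  by rewrite prodf_seq_neq0; apply/allP => j _; apply: g0.
exact: diff_scale.
Qed.

Lemma diff_neq0 p l : disc p != 0 -> diffm K p l != 0.
Proof.
move/disc_neq0P => h; rewrite /= /diff_nat mulf_neq0 ?h //.
by rewrite prodf_seq_neq0; apply/allP => j _; apply/implyP => _; apply: h.
Qed.

Lemma diff_pt p : disc p != 0 -> is_pt (diffm K p).
Proof. by move=> h []; exists ord0; rewrite // diff_neq0. Qed.

Lemma disc_points y : disc (pointsm K y) != 0 -> y ord0 != 0.
Proof.
move/disc_neq0P/(_ (Some ord0) None isT); rewrite br_points_infty.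
by rewrite oppr_eq0 expf_eq0.
Qed.

Lemma diff_points y :
  disc (pointsm K y) != 0 ->
  @eqpt K (projsp m.+1) y (diffm K (pointsm K y)).
Proof.
move/disc_points => w0; exists (fun=> y ord0 * (- y ord0 ^+ 2) ^+ m) => [_|l].
  by rewrite mulf_neq0 ?expf_neq0 // oppr_eq0 expf_neq0.
rewrite /= /diff_nat br_points full0 subr0 full_lift.
under eq_bigr => j _ do rewrite br_points_infty.
rewrite prodr_const.
have -> : #|[pred j | j != l]| = m by rewrite cardC1 card_ord.
by ring.
Qed.

Lemma points_diff p : disc p != 0 -> sim p (pointsm K (diffm K p)).
Proof.
move=> hp; have /disc_neq0P h := hp.
set y := diffm K p; pose kap := \prod_j br p (Some (lift ord0 j)) None.
have kap0 : kap != 0.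
  by rewrite prodf_seq_neq0; apply/allP => j _; apply: h.
have z0 i : br p (Some i) None != 0 by apply: h.
(* Up to [kap] this is the affine coordinate of the point [i]; for [i = ord0] both sides are 0. *)
have fullE i : full y i = kap * br p (Some i) (Some ord0) / br p (Some i) None.
  rewrite /full; case: unliftP => [l ->|->]; last by rewrite brxx mulr0 mul0r.
  rewrite /y /= /diff_nat /kap [in RHS](bigD1 l) //=.
  by field.
have w0 : y ord0 != 0 by apply: diff_neq0.
(* By [plucker], differences of these affine coordinates are brackets, which gives [d] and [g] on
   the finite points; the pairs with [None] then force [g None]. *)
clearbody y; pose d := y ord0 * kap * br p (Some ord0) None.
have d0 : d != 0 := mulf_neq0 (mulf_neq0 w0 kap0) (z0 ord0).
pose g (s : pt) := if s is Some i then (br p (Some i) None)^-1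
                   else - y ord0 ^+ 2 / d.
exists d, g; split=> [|[i|]|[i|] [j|]]; rewrite /g //.
- by rewrite invr_eq0.
- by rewrite mulf_neq0 ?invr_eq0 // oppr_eq0 expf_neq0.
- rewrite br_points !fullE.
  transitivity (y ord0 * kap * (br p (Some i) (Some ord0) * br p (Some j) None
    - br p (Some j) (Some ord0) * br p (Some i) None)
    / (br p (Some i) None * br p (Some j) None)).
    by field; rewrite !z0.
  by rewrite plucker /d; field; rewrite !z0.
- by rewrite br_points_infty /g; field; rewrite d0 z0.
- rewrite brC br_points_infty [br p None _]brC /g.
  by field; rewrite d0 z0.
- by rewrite !brxx mulr0.
Qed.

End Field.

(** * The permutation representation modulo constants *)

Section Representation.

Variables (gT : finGroupType) (G : {group gT}) (rho : gT -> 'I_m.+2 -> 'I_m.+2).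
Hypothesis rho1 : forall i, rho 1%g i = i.
(** A left action on the points, so that precomposition, as in [cact], is a right action on
    configurations. Permutations compose from left to right, so [rho g] will be the inverse of
    [g]. *)
Hypothesis rhoM : {in G &, forall g h i, rho (g * h)%g i = rho g (rho h i)}.

Lemma rho_inj g : g \in G -> injective (rho g).
Proof.
move=> gG i j /(congr1 (rho g^-1%g)).
by rewrite -!rhoM ?groupV // mulVg !rho1.
Qed.

(** Permuting the points moves the one at the origin; subtracting its new coordinate brings the
    origin back. This is the permutation action in the coordinates x_(l+1) - x_0. *)
Definition pact (R : comNzRingType) (g : gT) (y : 'I_m.+1 -> R) (l : 'I_m.+1) : R :=
  full y (rho g (lift ord0 l)) - full y (rho g ord0).

Lemma full_pact (R : comNzRingType) g (y : 'I_m.+1 -> R) i :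
  full (pact g y) i = full y (rho g i) - full y (rho g ord0).
Proof.
rewrite {1}/full; case: unliftP => [l ->|->] //.
by rewrite subrr.
Qed.

Definition perm_diff_mx (k : fieldType) (g : gT) : 'M[k]_m.+1 :=
  \matrix_(j, l) ((lift ord0 j == rho g (lift ord0 l))%:R
                  - (lift ord0 j == rho g ord0)%:R).

Lemma perm_diff_mxE (k : fieldType) g j l :
  perm_diff_mx k g j l = pact g (fun t => (j == t)%:R) l.
Proof.
rewrite mxE /pact -!full_sum.
have E i : \sum_t (j == t)%:R * (lift ord0 t == i)%:R
    = (lift ord0 j == i)%:R :> k.
  rewrite (bigD1 j) //= eqxx mul1r big1 ?addr0 // => t /negPf tj.
  by rewrite eq_sym tj mul0r.
by rewrite !E.
Qed.

Lemma perm_diff_mx_repr (k : fieldType) : mx_repr G (perm_diff_mx k).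
Proof.
split=> [|g h gG hG]; apply/matrixP => j l.
  by rewrite !mxE !rho1 (inj_eq lift_inj) subr0.
rewrite perm_diff_mxE !mxE.
under eq_bigr => t _ do rewrite perm_diff_mxE mxE mulrBr.
rewrite sumrB !full_sum !full_pact /pact !rhoM //.
by ring.
Qed.

Definition diff_repr (k : fieldType) : mx_representation k G m.+1 :=
  MxRepresentation (perm_diff_mx_repr k).

Lemma repr_actE (k : fieldType) (K : closedFieldType)
    (iota : {rmorphism k -> K}) g (y : vec K (projsp m.+1)) :
  repr_act iota (diff_repr k) g y =1 pact g y.
Proof.
move=> l; rewrite /repr_act /pact -!full_sum -sumrB; apply: eq_bigr => j _.
by rewrite mxE rmorphB !rmorph_nat mulrBr.
Qed.

Variable K : closedFieldType.
Implicit Types (p : pt * 'I_2 -> K) (y : 'I_m.+1 -> K).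

Definition cact (g : gT) (p : pt * 'I_2 -> K) (l : pt * 'I_2) : K :=
  p (omap (rho g) l.1, l.2).

Lemma br_cact g p s t :
  br (cact g p) s t = br p (omap (rho g) s) (omap (rho g) t).
Proof. by []. Qed.

Lemma cact_sim g p p' : sim p p' -> sim (cact g p) (cact g p').
Proof.
move=> [d [c [d0 c0 E]]]; exists d, (fun s => c (omap (rho g) s)).
by split=> // s t; rewrite !br_cact E.
Qed.

Lemma disc_cact g p : g \in G -> disc p != 0 -> disc (cact g p) != 0.
Proof.
move=> gG /disc_neq0P h; apply/disc_neq0P => s t st; rewrite br_cact; apply: h.
case: s t st => [i|] [j|] //= ij.
by apply: contra ij => /eqP[] /(rho_inj gG) ->.
Qed.

Lemma points_pact g y : g \in G -> disc (pointsm K y) != 0 ->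
  sim (cact g (pointsm K y)) (pointsm K (pact g y)).
Proof.
move=> gG hy; have w0 := disc_points hy.
have w'0 : pact g y ord0 != 0.
  have /disc_neq0P/(_ (Some (lift ord0 ord0)) (Some ord0) isT) := disc_cact gG hy.
  by rewrite br_cact /= br_points mulf_eq0 negb_or => /andP[_].
exists (pact g y ord0 / y ord0),
  (fun s => if s is Some _ then 1 else pact g y ord0 / y ord0).
split=> [|[i|]|[i|] [j|]]; rewrite ?mulf_neq0 ?invr_eq0 ?oner_neq0 //.
- by rewrite br_cact /= !br_points !full_pact; field.
- by rewrite br_cact /= !br_points_infty; field.
- rewrite br_cact /= brC [br _ None _]brC !br_points_infty.
  by field.
- by rewrite !brxx mulr0.
Qed.

Lemma diff_cact g p : g \in G -> disc p != 0 ->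
  eqpt (diffm K (cact g p)) (pact g (diffm K p)).
Proof.
move=> gG hp; have pZ := points_diff hp.
have hZ := sim_disc pZ hp.
have gpZ := sim_trans (cact_sim g pZ) (points_pact gG hZ).
apply: eqpt_trans (diff_sim gpZ) _; apply/eqpt_sym/diff_points.
exact: sim_disc gpZ (disc_cact gG hp).
Qed.

End Representation.

End AffineLine.

(** * A criterion for linearizability *)

Section Criterion.

Variables (k : fieldType) (K : closedFieldType) (iota : {rmorphism k -> K}).
Variables (m : nat) (gT : finGroupType) (G : {group gT}).
Variable rho : gT -> 'I_m.+2 -> 'I_m.+2.
Hypothesis rho1 : forall i, rho 1%g i = i.
Hypothesis rhoM : {in G &, forall g h i, rho (g * h)%g i = rho g (rho h i)}.

Variables (S : mspace) (X : vec K S -> Prop) (act : gT -> vec K S -> vec K S).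

Let pt : finType := option 'I_m.+2.

Variables (Psi : natmap (confsp pt) S) (Theta : natmap S (confsp pt)).
Variable Dl : natmap (confsp pt) (projsp 1).

Let good (p : vec K (confsp pt)) : Prop := Dl K p ord0 != 0.

Hypothesis good_disc : forall p, good p -> disc p != 0.
Hypothesis good_sim : forall p p' : vec K (confsp pt), sim p p' -> good p -> good p'.
Hypothesis good_act : forall g p, g \in G -> good p -> good (cact rho g p).
Hypothesis good_ex : exists p, good p.
Hypothesis Psi_sim : forall p p' : vec K (confsp pt),
  good p -> sim p p' -> eqpt (Psi K p) (Psi K p').
Hypothesis Psi_X : forall p x, good p -> eqpt (Psi K p) x -> X x.
Hypothesis X_pt : forall x, X x -> is_pt x.
Hypothesis ThetaPsi : forall p : vec K (confsp pt),
  good p -> sim p (Theta K (Psi K p)).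
Hypothesis PsiTheta : forall x, X x -> good (Theta K x) ->
  eqpt x (Psi K (Theta K x)).
Hypothesis act_eqpt : forall g x y, eqpt x y -> eqpt (act g x) (act g y).
Hypothesis Psi_act : forall g p, g \in G -> good p ->
  eqpt (Psi K (cact rho g p)) (act g (Psi K p)).
Hypothesis dense_good : dense X (fun x => good (Theta K x)).

(* The factors [Dl] make both maps undefined outside the loci where they are
   mutually inverse. *)
Let F : natmap S (projsp m.+1) :=
  mul_nm (comp_nm Dl Theta) (comp_nm (diffm m) Theta).
Let F' : natmap (projsp m.+1) S :=
  mul_nm (comp_nm Dl (pointsm m)) (comp_nm Psi (pointsm m)).

Let mulP (T U : mspace) (D : natmap T (projsp 1)) (H : natmap T U) (x : vec K T) :
  D K x ord0 != 0 -> eqpt (H K x) (mul_nm D H K x).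
Proof. by move=> D0; exists (fun=> D K x ord0). Qed.

Let rappP (T U : mspace) (H : natmap T U) x :
  eqpt (rapp iota (ratmap_of k H) x) (H K x).
Proof. by apply: eqpt_ext => j; rewrite rapp_ratmap. Qed.

Let rapp_pt (T U : mspace) (D : natmap T (projsp 1)) (H : natmap T U) x :
  (exists i : factor U, True) ->
  is_pt (rapp iota (ratmap_of k (mul_nm D H)) x) -> D K x ord0 != 0.
Proof.
move=> [i _] /(_ i)[j _]; rewrite rapp_ratmap /=.
by rewrite mulf_eq0 negb_or => /andP[].
Qed.

Let F_def x : is_pt (rapp iota (ratmap_of k F) x) -> good (Theta K x).
Proof. by apply: rapp_pt; exists tt. Qed.

Hypothesis S_ne : exists i : factor S, True.

Let F'_def y : is_pt (rapp iota (ratmap_of k F') y) -> good (pointsm m K y).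
Proof. exact: rapp_pt. Qed.

Let FE x : good (Theta K x) ->
  eqpt (diffm m K (Theta K x)) (rapp iota (ratmap_of k F) x).
Proof.
move=> gx; apply: eqpt_trans (eqpt_sym (rappP _ _)).
exact: (mulP (D := comp_nm Dl Theta) (comp_nm (diffm m) Theta)).
Qed.

Let F'E y : good (pointsm m K y) ->
  eqpt (Psi K (pointsm m K y)) (rapp iota (ratmap_of k F') y).
Proof.
move=> gy; apply: eqpt_trans (eqpt_sym (rappP _ _)).
exact: (mulP (D := comp_nm Dl (pointsm m)) (comp_nm Psi (pointsm m))).
Qed.

Let points_F x : good (Theta K x) ->
  sim (Theta K x) (pointsm m K (rapp iota (ratmap_of k F) x)).
Proof.
move=> gx; apply: sim_trans (points_diff (good_disc gx)) _.
by apply/eqpt_sim/eqpt_nm/FE.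
Qed.

Let Theta_F' y : good (pointsm m K y) ->
  sim (pointsm m K y) (Theta K (rapp iota (ratmap_of k F') y)).
Proof.
move=> gy; apply: sim_trans (ThetaPsi gy) _.
by apply/eqpt_sim/eqpt_nm/F'E.
Qed.

Let Psi_pt p : good p -> is_pt (Psi K p).
Proof. by move=> gp; apply/X_pt/(Psi_X gp)/eqpt_refl. Qed.

Let dense_points :
  dense (@is_pt K (projsp m.+1)) (fun y => good (pointsm m K y)).
Proof.
apply: (@dense_param K (projsp m.+1) _ _ 'I_m.+1 (fun R y => y)
  (comp_nm Dl (pointsm m))).
- by move=> R R' f x x' xx' j.
- exact: (nm_nat (comp_nm Dl (pointsm m))).
- have [p gp] := good_ex; exists (diffm m K p).
  exact: good_sim (points_diff (good_disc gp)) gp.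
- move=> y gy; split=> // -[].
  by exists ord0; rewrite // disc_points // good_disc.
- move=> y _; exists (fun j => (y j)%:P), (fun j => (y j)%:P), (fun=> 1), (fun=> 1).
  by split=> *; rewrite ?oner_neq0 ?hornerC.
Qed.

(** Both varieties are birational to configurations up to [sim]: X through [Psi] and [Theta], the
    projective space through [pointsm] and [diffm]. The criterion serves the moduli space itself in
    (a), and its product with P^1 in (b) and (c). *)
Lemma criterion_birational :
  equiv_birational iota G X act (@is_pt K (projsp m.+1))
    (repr_act iota (diff_repr rho1 rhoM k)).
Proof.
have reprE g y : eqpt (repr_act iota (diff_repr rho1 rhoM k) g y) (pact rho g y).
  by apply: (@eqpt_ext K (projsp m.+1)) => l; apply: repr_actE.
exists (ratmap_of k F), (ratmap_of k F'); split.
- by [].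
- by move=> y _ /F'_def gy; apply: Psi_X gy (F'E gy).
- split; split.
  + apply: sub_dense dense_good _ => x Xx gx.
    have gF := good_sim (points_F gx) gx.
    split; first exact: eqpt_is_pt (FE gx) (diff_pt (good_disc gx)).
    exact: eqpt_is_pt (F'E gF) (Psi_pt gF).
  + move=> x Xx /F_def gx /F'_def gF; apply: eqpt_trans (PsiTheta Xx gx) _.
    by apply: eqpt_trans (Psi_sim gx (points_F gx)) _; apply: F'E.
  + apply: sub_dense dense_points _ => y ypt gy.
    have gF' := good_sim (Theta_F' gy) gy.
    split; first exact: eqpt_is_pt (F'E gy) (Psi_pt gy).
    exact: eqpt_is_pt (FE gF') (diff_pt (good_disc gF')).
  + move=> y _ /F'_def gy /F_def gF'.
    apply: eqpt_trans (diff_points (good_disc gy)) _.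
    by apply: eqpt_trans (diff_sim (Theta_F' gy)) _; apply: FE.
- split=> g.
  + move=> x gG Xx /F_def gx /F_def ggx.
    have gcx := good_act gG gx.
    have h1 : sim (cact rho g (Theta K x)) (Theta K (act g x)).
      apply: sim_trans (ThetaPsi gcx) _; apply/eqpt_sim/eqpt_nm.
      apply: eqpt_trans (Psi_act gG gx) _; apply/eqpt_sym/act_eqpt.
      exact: PsiTheta.
    apply: eqpt_trans (eqpt_sym (FE ggx)) _.
    apply: eqpt_trans (eqpt_sym (diff_sim h1)) _.
    apply: eqpt_trans (diff_cact rho1 rhoM gG (good_disc gx)) _.
    apply: eqpt_trans (eqpt_sym (reprE _ _)) _.
    have [c c0 cE] := FE gx; exists c => // l.
    rewrite /repr_act mulr_sumr; apply: eq_bigr => i _.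
    by rewrite cE mulrA; congr (_ * _ * _); congr c; case: (blk i) (blk l) => -[].
  + move=> y gG _ /F'_def gy /F'_def ggy.
    apply: eqpt_trans (eqpt_sym (F'E ggy)) _.
    have gcy := good_act gG gy.
    apply: (@eqpt_trans _ _ (Psi K (cact rho g (pointsm m K y)))).
      apply/eqpt_sym/(Psi_sim gcy).
      apply: sim_trans (points_pact rho1 rhoM gG (good_disc gy)) _.
      by apply/eqpt_sim/eqpt_nm/eqpt_sym/reprE.
    by apply: eqpt_trans (Psi_act gG gy) _; apply/act_eqpt/F'E.
Qed.

End Criterion.

(** * The moduli space *)

Lemma mul_natural (I : Type) (D D' : nfun I 'I_1) :
  natural D -> natural D' -> natural (fun R v j => D R v j * D' R v j).
Proof.
by move=> nD nD' R R' f x x' xx' j; rewrite rmorphM (nD _ _ f x x') // (nD' _ _ f x x').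
Qed.

Section Disc.

Variable P : finType.

Lemma disc_scale (R : comNzRingType) (c : P -> R) (u : P * 'I_2 -> R) :
  disc (fun l => c l.1 * u l) = \prod_s c s ^+ (#|P|.-1 + #|P|.-1) * disc u.
Proof.
rewrite /disc; under eq_bigr => s _ do under eq_bigr => t _ do rewrite br_scale.
under eq_bigr => s _ do rewrite !big_split /= prodr_const.
rewrite !big_split /=; congr (_ * _).
under [RHS]eq_bigr => s _ do rewrite exprD.
rewrite big_split /=; congr (_ * _).
  by apply: eq_bigr => s _; rewrite cardC1.
rewrite (exchange_big_dep predT) //=; apply: eq_bigr => t _.
by rewrite prodr_const -(cardC1 t); congr (_ ^+ _); apply: eq_card => s; rewrite !inE eq_sym.
Qed.

Definition discm : natmap (confsp P) (projsp 1) :=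
  @NatMap (confsp P) (projsp 1) (fun R u _ => disc u)
    (fun _ _ => #|P|.-1 + #|P|.-1)%N (@disc_natural P)
    (fun R c x j => disc_scale c x).

End Disc.

Lemma crm_sim (n : nat) (K : closedFieldType) (u u' : vec K (confsp 'I_n)) :
  sim u u' -> eqpt (crm n K u) (crm n K u').
Proof.
move=> [d [g [d0 g0 E]]].
exists (fun q : quad n => d ^+ 2 * \prod_a g (val q a)) => [q|[q e]].
  by rewrite mulf_neq0 ?expf_neq0 // prodf_seq_neq0; apply/allP => a _; apply: g0.
exact: crq_scale.
Qed.

Section Density.

Variables (K : closedFieldType) (n : nat) (n3 : (3 <= n)%N).

Let n0 : (0 < n)%N. Proof. exact: ltn_trans n3. Qed.

Lemma Mbar_pt (x : vec K (crsp n)) : Mbar x -> is_pt x.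
Proof. by move=> [C []]. Qed.

Lemma dense_Mbar (U : vec K (crsp n) -> Prop) (D : nfun ('I_n * 'I_2) 'I_1) :
  natural D -> (exists u, D K u ord0 != 0) ->
  (forall u, disc u != 0 -> D K u ord0 != 0 -> U (crm n K u)) ->
  dense (@Mbar K n) U.
Proof.
move=> natD [u1 Du1] hU; have [u2 Du2] := distinct_ex K 'I_n.
apply: (@dense_param K (crsp n) _ _ ('I_n * 'I_2)%type (@cr_nat n)
  (fun R u j => D R u j * disc u)).
- exact: cr_natural.
- exact: mul_natural natD (@disc_natural _).
- have [w [h1 h2]] := generic_point2 natD (@disc_natural 'I_n) (j' := ord0) Du1 Du2.
  by exists w; rewrite mulf_neq0.
- move=> u; rewrite mulf_eq0 negb_or => /andP[Du du]; split; last exact: hU.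
  exact: (Mbar_smooth n3 du (eqpt_refl _)).
- move=> x Mx; have [u [y [c [c' [_ [c0 c'0] E yx]]]]] := Mbar_limit n0 Mx.
  by exists u, y, c, c'.
Qed.

Definition pair_nat (R : comNzRingType) (v : 'I_n * 'I_2 + 'I_2 -> R)
    (j : coord (prodsp (crsp n) (projsp 2))) : R :=
  match j with
  | inl a => cr_nat (fun l => v (inl l)) a
  | inr b => v (inr b)
  end.

Lemma pair_natural : natural pair_nat.
Proof.
by move=> R R' f v v' vv' [a|b] /=; [apply: cr_natural|rewrite vv'].
Qed.

Lemma dense_Mbar_P1 (U : vec K (prodsp (crsp n) (projsp 2)) -> Prop)
    (D : nfun ('I_n * 'I_2 + 'I_2) 'I_1) :
  natural D -> (exists v, D K v ord0 != 0) ->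
  (forall v, disc (fun l => v (inl l)) != 0 -> D K v ord0 != 0 ->
    U (pair_nat v)) ->
  dense (prodset (@Mbar K n) (@is_pt K (projsp 2))) U.
Proof.
move=> natD exD hU; have [u2 Du2] := distinct_ex K 'I_n.
pose D1 : nfun ('I_n * 'I_2 + 'I_2) 'I_1 := fun R v j => disc (fun l => v (inl l)).
(* A nonzero first coordinate makes the second component a point of P^1. *)
pose D2 : nfun ('I_n * 'I_2 + 'I_2) 'I_1 := fun R v j => v (inr 0).
have natD1 : natural D1.
  by move=> R R' f v v' vv' j; apply: (@disc_natural 'I_n _ _ f _ _ _ j) => l; apply: vv'.
have natD2 : natural D2 by move=> R R' f v v' vv' j; apply: vv'.
have exD1 : exists v, D1 K v ord0 != 0.
  by exists (fun l => if l is inl l' then u2 l' else 0).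
have exD2 : exists v, D2 K v ord0 != 0.
  by exists (fun=> 1); apply: oner_neq0.
apply: (@dense_param K (prodsp (crsp n) (projsp 2)) _ _
  ('I_n * 'I_2 + 'I_2)%type pair_nat
  (fun R v j => D R v j * D1 R v j * D2 R v j)).
- exact: pair_natural.
- exact: mul_natural (mul_natural natD natD1) natD2.
- have [v1 h1] := exD; have [v2 h2] := exD1; have [v3 h3] := exD2.
  have [w [g1 g2]] := generic_point2 natD natD1 h1 h2.
  have g12 : D K w ord0 * D1 K w ord0 != 0 by rewrite mulf_neq0.
  have [w' [h h']] := generic_point2 (mul_natural natD natD1) natD2 g12 h3.
  by exists w'; rewrite mulf_neq0.
- move=> v; rewrite !mulf_eq0 !negb_or => /andP[/andP[Dv D1v] D2v].
  split; last exact: hU.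
  split; first exact: (Mbar_smooth n3 D1v (eqpt_refl _)).
  by case; exists 0.
- move=> z [Mx wpt]; have [u [y [c [c' [_ [c0 c'0] E yx]]]]] := Mbar_limit n0 Mx.
  exists (fun l => match l with inl l' => u l' | inr b => (z (inr b))%:P end).
  exists (fun j => match j with inl a => y a | inr b => (z (inr b))%:P end).
  exists (fun i => if i is inl q then c q else 1),
    (fun i => if i is inl q then c' q else 1); split.
  + by case=> [q|_]; rewrite ?oner_neq0.
  + by case=> [q|_]; rewrite ?oner_neq0.
  + by case=> [a|b] /=; rewrite ?mul1r //; apply: E.
  + by case=> [a|b] /=; rewrite ?hornerC //; apply: yx.
Qed.

End Density.

Section Action.

Variables (k : fieldType) (K : closedFieldType) (iota : {rmorphism k -> K}).

(** A permutation of the coordinates is a single rational map, defined at every point of X. *)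
Lemma perm_regular (gT : finGroupType) (G : {group gT}) (S : mspace)
    (X : vec K S -> Prop) (act : gT -> vec K S -> vec K S)
    (f : gT -> coord S -> coord S) (fb : gT -> factor S -> factor S) :
  (forall g x j, act g x j = x (f g j)) ->
  (forall g j, blk (f g j) = fb g (blk j)) ->
  (forall j, f 1%g j = j) -> (forall g h j, f (g * h)%g j = f g (f h j)) ->
  (forall x, X x -> is_pt x) -> (forall g x, g \in G -> X x -> X (act g x)) ->
  regular_action iota G X act.
Proof.
move=> actE fE f1 fM Xpt XG; split=> // [x _|g h x _ _ _|g x gG Xx].
- by apply: eqpt_ext => j; rewrite actE f1.
- by apply: eqpt_ext => j; rewrite !actE fM.
pose F := perm_nm (fE g).
have FE y : rapp iota (ratmap_of k F) y =1 act g y.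
  by move=> j; rewrite rapp_ratmap actE.
exists (ratmap_of k F); split=> [|y Xy _].
  apply: (eqpt_is_pt (x := act g x)); last exact/Xpt/XG.
  by apply: eqpt_ext => j; rewrite FE.
by apply: eqpt_ext => j; rewrite FE.
Qed.

Variable n : nat.

Lemma quad_perm1 (q : quad n) : quad_perm 1^-1 q = q.
Proof. by apply: val_inj; apply/ffunP => a; rewrite ffunE invg1 perm1. Qed.

Lemma quad_permM (g h : 'S_n) (q : quad n) :
  quad_perm (g * h)^-1 q = quad_perm g^-1 (quad_perm h^-1 q).
Proof. by apply: val_inj; apply/ffunP => a; rewrite !ffunE invMg permM. Qed.

Lemma Mbar_act_Mbar g (x : vec K (crsp n)) : Mbar x -> Mbar (Mbar_act g x).
Proof. by move=> [C xC]; exists (relabel g C); apply: Mbar_act_relabel. Qed.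

Lemma Mbar_act_eqpt g (x y : vec K (crsp n)) :
  eqpt x y -> eqpt (Mbar_act g x) (Mbar_act g y).
Proof.
by move=> [c c0 cE]; exists (fun q => c (quad_perm g^-1 q)) => // j; apply: cE.
Qed.

Lemma Mbar_regular (G : {group 'S_n}) :
  regular_action iota G (@Mbar K n) (@Mbar_act K n).
Proof.
apply: (@perm_regular _ G (crsp n) _ _ (fun g j => (quad_perm g^-1 j.1, j.2))
  (fun g => quad_perm g^-1)) => //.
- by case=> q e; rewrite quad_perm1.
- by move=> g h [q e]; rewrite quad_permM.
- exact: Mbar_pt.
- by move=> g x _; apply: Mbar_act_Mbar.
Qed.

Lemma Mbar_P1_regular (G : {group 'S_n}) :
  regular_action iota G (prodset (@Mbar K n) (@is_pt K (projsp 2)))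
    (prodact (T := projsp 2) (@Mbar_act K n)).
Proof.
pose f (g : 'S_n) (j : coord (prodsp (crsp n) (projsp 2))) :
  coord (prodsp (crsp n) (projsp 2)) :=
  match j with inl a => inl (quad_perm g^-1 a.1, a.2) | inr b => inr b end.
pose fb (g : 'S_n) (i : factor (prodsp (crsp n) (projsp 2))) :
  factor (prodsp (crsp n) (projsp 2)) :=
  match i with inl q => inl (quad_perm g^-1 q) | inr b => inr b end.
apply: (@perm_regular _ G (prodsp (crsp n) (projsp 2)) _ _ f fb).
- by move=> g x [].
- by move=> g [].
- by case=> [[q e]|b] //=; rewrite quad_perm1.
- by move=> g h [[q e]|b] //=; rewrite quad_permM.
- move=> z [/Mbar_pt Mz wpt] [q|i].
    by have [j jq zj] := Mz q; exists (inl j); rewrite // -jq.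
  by have [j ji zj] := wpt i; exists (inr j); rewrite // -ji.
- by move=> g z _ [Mz wpt]; split=> //; apply: (Mbar_act_Mbar g Mz).
Qed.

End Action.

(** * Generic freeness *)

Section Free.

Variables (K : closedFieldType) (n : nat).
Hypothesis n4 : (4 <= n)%N.

(* After the points [q 0] and [q 3] have been made equal, the cross-ratio of
   [q] is infinite and that of [h q] is not. *)
Lemma free_quad (h : 'S_n) : h != 1%g -> (5 <= n)%N \/ (exists i, h i = i) ->
  exists q : quad n,
    let r i := if i == val q 3 then val q 0 else i in
    r (h (val q 0)) != r (h (val q 3)) /\ r (h (val q 1)) != r (h (val q 2)).
Proof.
move=> h1; have [j hj] : exists j, h j != j.
  apply/existsP; apply: contraNT h1; rewrite negb_exists => /forallP h0.
  by apply/eqP/permP => j; rewrite perm1; apply/eqP; rewrite -[_ == _]negbK.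
have avoid (a b : 'I_n) : a != b -> #|~: [set a; b]| = n.-2.
  by move=> ab; rewrite cardsCs setCK card_ord cards2 ab subn2.
case=> [n5|[i hi]].
  (* None of the four points chosen is [j], so [h j] is not among their images, and identifying [t]
     with [h j] keeps these images distinct. This takes three points besides [j] and [h j]. *)
  have ba : j != h j by rewrite eq_sym.
  have : (2 < #|~: [set h j; j]|)%N by rewrite avoid // -subn2 ltn_subRL.
  case/card_gt2P => x [y [t [[xA yA tA] [xy yt tx]]]].
  move: xA yA tA; rewrite !inE !negb_or => /andP[xa xb] /andP[ya yb] /andP[ta tb].
  have [||q [q0 q1 q2 q3]] := @quad4_ex n (h j) x y t.
  - by split; rewrite eq_sym.
  - by split; rewrite // eq_sym.
  exists q => r; rewrite /r q0 q1 q2 q3.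
  have inj i i' : i != i' -> i != j -> i' != j -> r (h i) != r (h i').
    move=> ii' ij i'j; rewrite /r q0 q3.
    have hii' : h i != h i' by rewrite (inj_eq perm_inj).
    have [E|_] := eqVneq (h i) t.
      rewrite -E [h i' == _]eq_sym (negPf hii') (inj_eq perm_inj).
      by rewrite eq_sym.
    by case: ifP => _ //; rewrite (inj_eq perm_inj).
  by split; move: inj; rewrite /r q0 q3; apply; rewrite // eq_sym.
(* Now the moved point [j] itself is merged with the fixed point [i]; as [i] is the image of no
   other point, the images stay apart where needed. *)
have ij : i != j by apply/eqP => ij; rewrite -ij hi eqxx in hj.
have : (1 < #|~: [set i; j]|)%N by rewrite avoid // -subn2 ltn_subRL.
case/card_gt1P => x [y [xA yA xy]].
move: xA yA; rewrite !inE !negb_or => /andP[xi xj] /andP[yi yj].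
have [||q [q0 q1 q2 q3]] := @quad4_ex n i x y j.
- by split; rewrite // eq_sym.
- by split.
exists q => r; rewrite /r q0 q1 q2 q3 hi (negPf ij) (negPf hj).
have hz z : z != i -> h z != i by rewrite -{2}hi (inj_eq perm_inj).
split; first by rewrite eq_sym hz // eq_sym.
have hxy : h x != h y by rewrite (inj_eq perm_inj).
have [E|_] := eqVneq (h x) j; first by rewrite -E [h y == _]eq_sym (negPf hxy) eq_sym hz.
by case: ifP => _ //; rewrite hz.
Qed.

Definition moved (g : 'S_n) (q : quad n) : nfun ('I_n * 'I_2) 'I_1 :=
  fun R u _ => dt (crq (br u) (quad_perm g^-1 q)) (crq (br u) q).

Lemma moved_natural g q : natural (moved g q).
Proof.
move=> R R' f u u' uu' l.
have crE q' e : crq (br u') q' e = f (crq (br u) q' e).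
  by apply: crq_natural => i j; apply: br_natural.
by rewrite /moved /dt !crE rmorphB !rmorphM.
Qed.

(** The witness has two equal points, so it is not a smooth curve. This is harmless: it only shows
    that the polynomial [moved g q] is not zero. *)
Lemma moved_ex (g : 'S_n) : g != 1%g -> (5 <= n)%N \/ (exists i, g i = i) ->
  exists (q : quad n) (u : 'I_n * 'I_2 -> K), moved g q u ord0 != 0.
Proof.
move=> g1 hg; have [||q] := @free_quad g^-1.
- by rewrite invg_eq1.
- by case: hg => [|[i gi]]; [left|right; exists i; rewrite -{1}gi permK].
set r := fun i => _; move=> [r03 r12].
have [u /disc_neq0P hu] := distinct_ex K 'I_n.
exists q, (fun l => u (r l.1, l.2)); rewrite /moved /dt /crq /= !ffunE.
have brE i j : br (fun l => u (r l.1, l.2)) i j = br u (r i) (r j) by [].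
rewrite !brE; have -> : r (val q 0) = val q 0.
  by rewrite /r; case: ifP.
have -> : r (val q 3) = val q 0 by rewrite /r eqxx.
have rq a : a != 3 -> r (val q a) = val q a.
  by move=> a3; rewrite /r (negPf (quad_neq q a3)).
rewrite !rq // brxx mul0r mulr0 sub0r oppr_eq0 !mulf_neq0 ?hu //.
  exact: quad_neq.
exact: quad_neq.
Qed.

Variable G : {group 'S_n}.
(** For n = 4 the double transpositions act trivially on all cross-ratios; a fixed point excludes
    them. *)
Hypothesis freeG : forall g, g \in G -> (5 <= n)%N \/ (exists i, g i = i).

Lemma free_ex : exists D : nfun ('I_n * 'I_2) 'I_1,
  [/\ natural D, exists u, D K u ord0 != 0
    & forall u : 'I_n * 'I_2 -> K, D K u ord0 != 0 -> disc u != 0 /\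
        forall g, g \in G -> g != 1%g -> exists q, moved g q u ord0 != 0].
Proof.
have [q0 _] := quad_inh n4.
have [q qP] : exists q : 'S_n -> quad n, forall g, g \in G -> g != 1%g ->
    exists u : 'I_n * 'I_2 -> K, moved g (q g) u ord0 != 0.
  apply: (@fin_all_exists 'S_n (fun=> quad n) (fun g q => g \in G -> g != 1%g ->
    exists u : 'I_n * 'I_2 -> K, moved g q u ord0 != 0)) => g.
  have [gG|] := boolP (g \in G); last by exists q0.
  have [->|g1] := eqVneq g 1%g; first by exists q0; rewrite ?eqxx.
  by have [q hq] := moved_ex g1 (freeG gG); exists q.
pose F (o : option 'S_n) : nfun ('I_n * 'I_2) 'I_1 :=
  if o is Some g then moved g (q g) else fun R u _ => disc u.
have natF o : natural (F o).
  by case: o => [g|]; [exact: moved_natural|exact: (@disc_natural 'I_n)].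
pose D : nfun ('I_n * 'I_2) 'I_1 := fun R u j =>
  disc u * \prod_(g in G :\ 1%g) F (Some g) R u j.
exists D; split=> [R R' f u u' uu' j||u].
- rewrite /D rmorphM rmorph_prod; congr (_ * _).
    exact: (@disc_natural 'I_n _ _ f u u' uu' j).
  by apply: eq_bigr => g _; apply: natF.
- have [//||u hu] := @generic_point K _ _
      (None :: [seq Some g | g <- enum (G :\ 1%g)]) F.
    move=> o; rewrite inE => /orP[/eqP ->|/mapP[g]]; first exact: distinct_ex.
    by rewrite mem_enum !inE => /andP[g1 gG] ->; apply: qP.
  exists u; rewrite /D mulf_neq0 //; first by apply: (hu None); rewrite mem_head.
  rewrite prodf_seq_neq0; apply/allP => g _; apply/implyP => hg; apply: hu.
  by rewrite inE /=; apply/mapP; exists g; rewrite ?mem_enum.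
rewrite /D mulf_eq0 negb_or => /andP[hu]; rewrite prodf_seq_neq0 => /allP Fu.
split=> // g gG g1; exists (q g).
by have := Fu g (mem_index_enum _); rewrite !inE g1 gG.
Qed.

Lemma eqpt_moved (u : vec K (confsp 'I_n)) g q :
  eqpt (Mbar_act g (crm n K u)) (crm n K u) -> moved g q u ord0 = 0.
Proof.
move=> [c c0 cE].
have cE' e : crq (br u) q e = c q * crq (br u) (quad_perm g^-1 q) e.
  exact: (cE (q, e)).
by rewrite /moved /dt !cE' mulrCA [X in _ - X]mulrCA [crq _ _ 0 * _]mulrC subrr.
Qed.

End Free.

Lemma base_ex (n : nat) : (4 <= n)%N -> exists (a b c : 'I_n) (qd : 'I_n -> quad n),
  [/\ a != b, a != c, b != c & forall i, i != a -> i != b -> i != c ->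
    [/\ val (qd i) 0 = i, val (qd i) 1 = b, val (qd i) 2 = a & val (qd i) 3 = c]].
Proof.
move=> n4; have [q _] := quad_inh n4.
set a := val q 0; set b := val q 1; set c := val q 2.
have ab : a != b by apply: quad_neq.
have ac : a != c by apply: quad_neq.
have bc : b != c by apply: quad_neq.
have [qd qdE] : exists qd : 'I_n -> quad n, forall i,
    i != a -> i != b -> i != c ->
    [/\ val (qd i) 0 = i, val (qd i) 1 = b, val (qd i) 2 = a & val (qd i) 3 = c].
  apply: (@fin_all_exists 'I_n (fun=> quad n) (fun i q' =>
    i != a -> i != b -> i != c ->
    [/\ val q' 0 = i, val q' 1 = b, val q' 2 = a & val q' 3 = c])) => i.
  have [->|ia] := eqVneq i a; first by exists q.
  have [->|ib] := eqVneq i b; first by exists q.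
  have [->|ic] := eqVneq i c; first by exists q.
  have [//||q' hq'] := @quad4_ex n i b a c; last by exists q'.
  by rewrite eq_sym ab.
by exists a, b, c, qd.
Qed.

Lemma Mbar_free (K : closedFieldType) (n : nat) (G : {group 'S_n}) :
  (4 <= n)%N ->
  (forall g, g \in G -> (5 <= n)%N \/ (exists i, g i = i)) ->
  generically_free G (@Mbar K n) (@Mbar_act K n).
Proof.
move=> n4 hG; have [D [natD exD freeD]] := free_ex K n4 hG.
apply: (dense_Mbar (ltnW n4) natD exD) => u _ Du g gG.
move=> hg; apply/eqP/negPn/negP => g1.
have [_ /(_ g gG g1)[q]] := freeD u Du.
by rewrite (eqpt_moved q hg) eqxx.
Qed.

Lemma comp_sim (K : closedFieldType) (P P' : Type) (f : P -> P')
    (p p' : P' * 'I_2 -> K) :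
  sim p p' -> sim (fun l => p (f l.1, l.2)) (fun l => p' (f l.1, l.2)).
Proof.
move=> [d [g [d0 g0 E]]]; exists d, (fun s => g (f s)); split=> // s t.
exact: (E (f s) (f t)).
Qed.

Lemma disc_comp (K : closedFieldType) (P P' : finType) (f : P -> P')
    (p : P' * 'I_2 -> K) : injective f ->
  disc p != 0 -> disc (fun l => p (f l.1, l.2)) != 0.
Proof.
move=> f_inj /disc_neq0P h; apply/disc_neq0P => s t st.
by apply: (h (f s) (f t)); rewrite (inj_eq f_inj).
Qed.

Definition relabelm (P P' : finType) (f : P -> P') :
    natmap (confsp P') (confsp P) :=
  @perm_nm (confsp P') (confsp P) (fun l => (f l.1, l.2)) f (fun _ => erefl).

(** * A fixed marked point *)

Section FixedPoint.

Variables (k : fieldType) (K : closedFieldType) (iota : {rmorphism k -> K}).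
Variables (m : nat) (m1 : (1 <= m)%N) (G : {group 'S_m.+3}).
Hypothesis fixG : forall g : 'S_m.+3, g \in G -> g ord_max = ord_max.

Let n := m.+3.
Let pt : finType := option 'I_m.+2.

Let toI (s : pt) : 'I_n := oapp (lift ord_max) ord_max s.
Let ofI (i : 'I_n) : pt := unlift ord_max i.

Let ofIK : cancel ofI toI.
Proof. by move=> i; rewrite /ofI /toI; case: unliftP => [j ->|->]. Qed.

Let toIK : cancel toI ofI.
Proof. by case=> [j|]; rewrite /ofI /toI /= ?liftK ?unlift_none. Qed.

(** The last marked point is [None]. For [g] in G the default [j] is never reached, as the inverse
    of [g] fixes that point; the inverse is the one in [Mbar_act]. *)
Let rho (g : 'S_n) (j : 'I_m.+2) : 'I_m.+2 :=
  odflt j (ofI ((g^-1)%g (lift ord_max j))).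

Let rhoE g i : g \in G -> ofI ((g^-1)%g i) = omap (rho g) (ofI i).
Proof.
move=> gG; rewrite -{1}[i]ofIK; case: (ofI i) => [j|] /=; last first.
  by rewrite fixG ?groupV // /ofI unlift_none.
rewrite /rho; case E: (ofI _) => [//|].
have : lift ord_max j = ord_max.
  apply: (@perm_inj _ g^-1%g); rewrite [RHS]fixG ?groupV //.
  by rewrite -[LHS]ofIK E.
by move/eqP; rewrite eq_sym (negPf (neq_lift _ _)).
Qed.

Let rho1 j : rho 1%g j = j.
Proof. by rewrite /rho invg1 perm1 /ofI liftK. Qed.

Let rhoM : {in G &, forall g h i, rho (g * h)%g i = rho g (rho h i)}.
Proof.
move=> g h gG hG i.
have sE x (xG : x \in G) j : toI (Some (rho x j)) = (x^-1)%g (toI (Some j)).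
  by rewrite -[RHS]ofIK rhoE // toIK.
have : toI (Some (rho (g * h)%g i)) = toI (Some (rho g (rho h i))).
  by rewrite !sE ?groupM // invMg permM.
by move/(can_inj toIK) => [].
Qed.

Lemma fixed_linearizable : linearizable iota G (@Mbar K n) (@Mbar_act K n).
Proof.
have n4 : (4 <= n)%N by [].
have [a [b [c [qd [ab ac bc qdE]]]]] := base_ex n4.
split; first exact: Mbar_regular.
  by apply: Mbar_free => // g gG; right; exists ord_max; apply: fixG.
exists m.+1, (diff_repr rho1 rhoM k).
pose Psi := comp_nm (crm n) (relabelm ofI).
pose Theta := comp_nm (relabelm toI) (normm a b c qd).
have ofI_sim (p p' : vec K (confsp pt)) : sim p p' ->
    sim (relabelm ofI K p) (relabelm ofI K p') := @comp_sim K _ _ ofI p p'.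
have toI_disc := @disc_comp K _ _ toI _ (can_inj toIK).
have ofI_disc := @disc_comp K _ _ ofI _ (can_inj ofIK).
have ofI_toI (u : vec K (confsp 'I_n)) : relabelm ofI K (relabelm toI K u) =1 u.
  by move=> [i e]; rewrite /= ofIK.
apply: (@criterion_birational k K iota m _ G rho rho1 rhoM _ _ _ Psi Theta (discm pt)).
- by [].
- exact: sim_disc.
- by move=> g p gG; apply: (disc_cact rho1 rhoM gG).
- exact: (distinct_ex K pt).
- by move=> p p' _ pp'; apply/crm_sim/ofI_sim.
- by move=> p x dp px; apply: (Mbar_smooth (ltnW n4) (ofI_disc _ dp) px).
- exact: Mbar_pt.
- move=> p dp; have := norm_crm_sim ab ac bc qdE (ofI_disc _ dp).
  move/(@comp_sim K _ _ toI); apply: sim_trans.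
  by apply/eqpt_sim/eqpt_ext => -[s e] /=; rewrite toIK.
- move=> x Mx dx; have du : disc (normm a b c qd K x) != 0.
    apply: (sim_disc (p := relabelm ofI K (relabelm toI K (normm a b c qd K x)))).
      by apply/eqpt_sim/eqpt_ext/ofI_toI.
    exact: ofI_disc.
  apply: eqpt_trans (crm_norm_Mbar ab ac bc qdE Mx du) _.
  by apply/eqpt_nm/eqpt_ext => l; rewrite ofI_toI.
- exact: Mbar_act_eqpt.
- move=> g p gG _; apply: eqpt_ext => -[q e] /=.
  rewrite /Mbar_act /cr_nat /=; rewrite /crq /= !ffunE /br /dt /cact /=.
  by rewrite !rhoE.
- apply: (dense_Mbar (ltnW n4) (D := comp_nm (discm pt) (comp_nm Theta (crm n)))) => //.
  + exact: (nm_nat (comp_nm (discm pt) (comp_nm Theta (crm n)))).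
  + have [u du] := distinct_ex K 'I_n; exists u.
    apply: toI_disc.
    exact: sim_disc (norm_crm_sim ab ac bc qdE du) du.
- exact: quad_inh.
Qed.

End FixedPoint.

(** * Linear covariants *)

(** Brackets of consecutive entries. It will be applied to the points of [A] other than [a], which
    are even in number if [a] is in [A]. *)
Fixpoint pairprod (R : comNzRingType) (T : Type) (b : T -> T -> R) (s : seq T) : R :=
  if s is x :: y :: s' then b x y * pairprod b s' else 1.

Lemma pairprod_ind (T : Type) (Q : seq T -> Prop) :
  Q [::] -> (forall x, Q [:: x]) -> (forall x y s, Q s -> Q (x :: y :: s)) ->
  forall s, Q s.
Proof.
move=> Q0 Q1 Q2 s; have [k] := ubnP (size s); elim: k s => // k IHk [|x [|y s]] //= hs.
by apply/Q2/IHk; rewrite -ltnS; apply: ltnW.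
Qed.

Lemma pairprod_scale (R : comNzRingType) (T : Type) (b b' : T -> T -> R) d
    (c : T -> R) s :
  (forall i j, b' i j = d * c i * c j * b i j) -> ~~ odd (size s) ->
  pairprod b' s = d ^+ (size s)./2 * \prod_(i <- s) c i * pairprod b s.
Proof.
move=> E; elim/pairprod_ind: s => [|x|x y s IHs] //= es.
  by rewrite big_nil !mulr1.
rewrite negbK in es; rewrite IHs // E !big_cons exprS.
by ring.
Qed.

Lemma pairprod_natural (R R' : comNzRingType) (f : {rmorphism R -> R'})
    (T : Type) (b : T -> T -> R) (b' : T -> T -> R') s :
  (forall i j, b' i j = f (b i j)) -> pairprod b' s = f (pairprod b s).
Proof.
move=> E; elim/pairprod_ind: s => [|x|x y s IHs] /=; rewrite ?rmorph1 //.
by rewrite rmorphM IHs E.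
Qed.

Lemma pairprod_neq0 (R : idomainType) (T : eqType) (b : T -> T -> R) s :
  (forall i j, i != j -> b i j != 0) -> uniq s -> pairprod b s != 0.
Proof.
move=> b0; elim/pairprod_ind: s => [|x|x y s IHs] //=; rewrite ?oner_neq0 //.
rewrite inE negb_or => /and3P[/andP[xy _] _ us].
by rewrite mulf_neq0 ?b0 ?IHs.
Qed.

Lemma sum_ord2 (R : comNzRingType) (f : 'I_2 -> R) : \sum_e f e = f 0 + f 1.
Proof. by rewrite big_ord_recl big_ord1; congr (f _ + f _); apply: val_inj. Qed.

Section Covariant.

Variables (n : nat) (G : {group 'S_n}) (A : {set 'I_n}).
Hypothesis oddA : odd #|A|.
Hypothesis GA : forall g : 'S_n, g \in G -> g @: A = A.

(** One cross-ratio for each quadruple and each permutation [s]: the factor of index [(q0 s, s)] is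
    there to kill the term of [s] in [cov_span], and running over all quadruples makes the
    multidegree invariant under permutations. In [coef], [h] selects one coordinate of each
    cross-ratio. *)
Let idx : finType := (quad n * 'S_n)%type.

Definition coef (R : comNzRingType) (h : {ffun idx -> 'I_2}) (a : 'I_n)
    (b : 'I_n -> 'I_n -> R) : R :=
  (\prod_i crq b i.1 (h i)) * pairprod b (enum (A :\ a)).

(* When [b i j] is the bracket of the points [i] and [j], and [f i] is linear
   in the point [i], this is homogeneous of odd degree in each of the points
   of [A] and of even degree in the others. *)
Definition cov (R : comNzRingType) (h : {ffun idx -> 'I_2}) (a : 'I_n)
    (b : 'I_n -> 'I_n -> R) (f : 'I_n -> R) : R :=
  \sum_(s in G) coef h a (fun i j => b (s i) (s j)) * f (s a).

Lemma cov_natural (R R' : comNzRingType) (phi : {rmorphism R -> R'}) h a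
    (b : 'I_n -> 'I_n -> R) (b' : 'I_n -> 'I_n -> R') f f' :
  (forall i j, b' i j = phi (b i j)) -> (forall i, f' i = phi (f i)) ->
  cov h a b' f' = phi (cov h a b f).
Proof.
move=> bE fE; rewrite rmorph_sum; apply: eq_bigr => s _.
rewrite rmorphM fE; congr (_ * _); rewrite /coef rmorphM rmorph_prod.
congr (_ * _); last exact: pairprod_natural.
by apply: eq_bigr => i _; apply: crq_natural.
Qed.

Definition cov_factor (R : comNzRingType) (c : 'I_n -> R) : R :=
  (\prod_(x : idx * 'I_4) c (val x.1.1 x.2)) * \prod_(i in A) c i.

(** The number of brackets in a term: two in each cross-ratio coordinate, and (#|A| - 1) / 2 in the
    matching. *)
Definition cov_exp : nat := (2 * #|idx| + #|A|./2)%N.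

Lemma stab_mem g i : g \in G -> (g i \in A) = (i \in A).
Proof. by move=> gG; rewrite -{1}(GA gG) mem_imset //; apply: perm_inj. Qed.

Lemma quad_perm_inj (g : 'S_n) : injective (quad_perm g).
Proof.
move=> q q' /(congr1 val) /= E; apply: val_inj; apply/ffunP => a.
by move/ffunP/(_ a): E; rewrite !ffunE => /perm_inj.
Qed.

(** Every term gets the same factor: [s] permutes the quadruples, and it permutes [A], which is
    exhausted by the matched points and [s a]. The matching is perfect because [A] is odd. The
    weight [t] belongs to the other vector that enters [f]. *)
Lemma cov_scale (R : comNzRingType) h a (b b' : 'I_n -> 'I_n -> R) f f' d c t :
  a \in A -> (forall i j, b' i j = d * c i * c j * b i j) ->
  (forall i, f' i = t * c i * f i) ->
  cov h a b' f' = d ^+ cov_exp * cov_factor c * t * cov h a b f.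
Proof.
move=> aA bE fE; rewrite mulr_sumr; apply: eq_bigr => s sG.
rewrite fE /coef.
have -> : \prod_i crq (fun i j => b' (s i) (s j)) i.1 (h i)
    = d ^+ (2 * #|idx|) * \prod_(x : idx * 'I_4) c (val x.1.1 x.2)
      * \prod_i crq (fun i j => b (s i) (s j)) i.1 (h i).
  under eq_bigr => i _ do
    rewrite (@crq_scale n _ (fun i j => b (s i) (s j)) _ d (fun i => c (s i))) //.
  rewrite 2!big_split /= prodr_const exprM; congr (_ * _ * _).
  transitivity (\prod_(i : idx) \prod_(e : 'I_4) c (val i.1 e)); last first.
    by rewrite pair_bigA.
  rewrite [RHS](reindex_inj (h := fun i : idx => (quad_perm s i.1, i.2))) /=.
    by apply: eq_bigr => i _; apply: eq_bigr => e _; rewrite ffunE.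
  move=> [q x] [q' x'] /= E.
  have E1 : quad_perm s q = quad_perm s q' := congr1 (fun p => p.1) E.
  by rewrite (quad_perm_inj E1) (congr1 (fun p => p.2) E : x = x').
have szA : size (enum (A :\ a)) = #|A|.-1.
  by rewrite -cardE [#|A|](cardsD1 a) aA.
have oA : ~~ odd (size (enum (A :\ a))).
  by rewrite szA; move: oddA; case: #|A| => //= m; rewrite ?negbK.
rewrite (@pairprod_scale _ _ (fun i j => b (s i) (s j)) _ d (fun i => c (s i))) //.
have -> : (size (enum (A :\ a)))./2 = #|A|./2.
  by rewrite szA; move: oddA; case: #|A| => //= m /negPf om; rewrite uphalf_half om.
have cA : \prod_(i in A) c i = (\prod_(i <- enum (A :\ a)) c (s i)) * c (s a).
  rewrite (reindex_inj (@perm_inj _ s)) /= (eq_bigl (mem A)); last first.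
    by move=> i; rewrite stab_mem.
  rewrite (bigD1 a) //= mulrC; congr (_ * _); rewrite big_enum /=.
  by apply: eq_bigl => i; rewrite !inE andbC.
rewrite /cov_factor cA /cov_exp exprD.
move: (d ^+ _) (d ^+ (2 * _)) => x y; move: (\prod_(x0 : idx * 'I_4) _) => z.
by ring.
Qed.

Lemma cov_act (R : comNzRingType) h a (b : 'I_n -> 'I_n -> R) f g : g \in G ->
  cov h a (fun i j => b (g i) (g j)) (fun i => f (g i)) = cov h a b f.
Proof.
move=> gG; rewrite /cov [RHS](reindex_inj (mulIg g)) /=.
apply: eq_big => [s|s _]; first by rewrite groupMr.
rewrite permM; congr (_ * _); rewrite /coef; congr (_ * _).
  by apply: eq_bigr => i _; apply: eq_crq => x y; rewrite !permM.
by apply: (pairprod_natural (f := idfun)) => x y; rewrite !permM.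
Qed.

Definition covec (R : comNzRingType) h a (u : 'I_n * 'I_2 -> R) (e : 'I_2) : R :=
  cov h a (br u) (fun i => u (i, e)).

Lemma dt_covec (R : comNzRingType) h a (u : 'I_n * 'I_2 -> R) (x : 'I_2 -> R) :
  dt (covec h a u) x = cov h a (br u) (fun i => dt (fun e => u (i, e)) x).
Proof.
rewrite /dt /covec /cov !mulr_suml -sumrB; apply: eq_bigr => s _.
by rewrite mulrBr !mulrA.
Qed.

Lemma dt_covecr (R : comNzRingType) h a (u : 'I_n * 'I_2 -> R) (x : 'I_2 -> R) :
  dt x (covec h a u) = cov h a (br u) (fun i => dt x (fun e => u (i, e))).
Proof.
rewrite /dt /covec /cov !mulr_sumr -sumrB; apply: eq_bigr => s _.
by rewrite mulrBr; congr (_ - _); rewrite mulrCA.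
Qed.

Definition cov_deg (i : 'I_n) : nat :=
  (\sum_(x : idx * 'I_4) (val x.1.1 x.2 == i) + (i \in A))%N.

Lemma covec_natural h a : natural (fun R => @covec R h a).
Proof.
move=> R R' f u u' uu' e; apply: cov_natural => [i j|i]; last exact: uu'.
exact: br_natural.
Qed.

Lemma cov_factorE (R : comNzRingType) (c : 'I_n -> R) :
  cov_factor c = \prod_i c i ^+ cov_deg i.
Proof.
under eq_bigr => i _ do rewrite exprD.
rewrite big_split /= prod_sum_eq; congr (_ * _).
by rewrite big_mkcond /=; apply: eq_bigr => i _; case: ifP.
Qed.

Lemma covec_graded h a : a \in A ->
  @graded (confsp 'I_n) (projsp 2) (fun R => @covec R h a) (fun _ => cov_deg).
Proof.
move=> aA R c u e; rewrite -cov_factorE.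
rewrite [LHS](@cov_scale _ h a (br u) _ (fun i => u (i, e)) _ 1 c 1) //.
- by rewrite expr1n mul1r mulr1.
- by move=> i j; rewrite br_scale mul1r.
- by move=> i; rewrite mul1r.
Qed.

Section Independent.

Variables (K : closedFieldType) (u : 'I_n * 'I_2 -> K).
Hypothesis n4 : (4 <= n)%N.
Hypothesis du : disc u != 0.
Hypothesis freeu : forall g, g \in G -> g != 1%g ->
  exists q, moved g q u ord0 != 0.

(* Lagrange interpolation on the orbit of [u]: expanding a product of linear
   forms in cross-ratios that vanishes at all its points except [u], one gets
   a linear combination of the covariants in which only the term of the
   identity survives. *)
Lemma cov_span (a : 'I_n) (f : 'I_n -> K) : a \in A ->
  (forall h, cov h a (br u) f = 0) -> f a = 0.
Proof.
move=> aA f0.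
have [q0 q0P] : exists q0 : 'S_n -> quad n, forall g, g \in G -> g != 1%g ->
    moved g^-1 (q0 g) u ord0 != 0.
  apply: (@fin_all_exists 'S_n (fun=> quad n) (fun g q => g \in G -> g != 1%g ->
    moved g^-1 q u ord0 != 0)) => g.
  have [q _] := quad_inh n4.
  have [gG|] := boolP (g \in G); last by exists q.
  have [->|g1] := eqVneq g 1%g; first by exists q; rewrite ?eqxx.
  by have [|q' hq'] := freeu (groupVr gG); [rewrite invg_eq1|exists q'].
pose vanish (x : idx) := [&& x.2 \in G, x.2 != 1%g & x.1 == q0 x.2].
(* For [x = (q0 s, s)] with [s] a nontrivial element of G, the linear form that vanishes at the
   cross-ratio permuted by [s]; for the other indices the first coordinate, which is nonzero at
   distinct points. *)
pose lam (x : idx) (e : 'I_2) : K := if vanish x then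
    (if e == 0 then crq (br u) (quad_perm x.2 x.1) 1
     else - crq (br u) (quad_perm x.2 x.1) 0)
  else (e == 0)%:R.
pose val_at (s : 'S_n) x := \sum_e lam x e * crq (br u) (quad_perm s x.1) e.
have crE (s : 'S_n) q e :
    crq (fun i j => br u (s i) (s j)) q e = crq (br u) (quad_perm s q) e.
  by rewrite /crq /= !ffunE.
have : \sum_(h : {ffun idx -> 'I_2}) (\prod_x lam x (h x)) * cov h a (br u) f = 0.
  by rewrite big1 // => h _; rewrite f0 mulr0.
rewrite /cov; under eq_bigr => h _ do rewrite mulr_sumr.
rewrite exchange_big /=.
(* The sum over all choices [h] of coordinates is an expanded product of linear forms. *)
have term (s : 'S_n) : \sum_(h : {ffun idx -> 'I_2}) (\prod_x lam x (h x)) *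
      (coef h a (fun i j => br u (s i) (s j)) * f (s a))
    = \prod_x val_at s x
      * (pairprod (fun i j => br u (s i) (s j)) (enum (A :\ a)) * f (s a)).
  rewrite /val_at bigA_distr_bigA /= mulr_suml; apply: eq_bigr => h _.
  rewrite /coef !mulrA -big_split /=; congr (_ * _ * _).
  by apply: eq_bigr => x _; rewrite crE.
under eq_bigr => s _ do rewrite term.
rewrite (bigD1 1%g) ?group1 //= [X in _ + X]big1 ?addr0 => [|s /andP[sG s1]].
  move/eqP; rewrite !mulf_eq0 perm1 => /or3P[|/eqP h|/eqP //].
    rewrite prodf_seq_eq0 => /hasP[x _] /= /eqP h; exfalso; move: h; apply/eqP.
    have -> : val_at 1%g x = \sum_e lam x e * crq (br u) x.1 e.
      by have := quad_perm1 x.1; rewrite /val_at invg1 => ->.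
    rewrite sum_ord2 /lam; case: ifP => [/and3P[xG x1 /eqP xq]|_] /=.
      have := q0P _ xG x1; rewrite -xq /moved /dt invgK -oppr_eq0; congr (_ != _).
      by rewrite opprB mulNr.
    by rewrite mul1r mul0r addr0 crq_neq0.
  exfalso; move: h; apply/eqP/pairprod_neq0; last exact: enum_uniq.
  by move=> i j ij; rewrite !perm1; apply: (iffLR (disc_neq0P u) du).
rewrite (bigD1 (q0 s, s)) //= [val_at _ _](_ : _ = 0) ?mul0r //.
rewrite /val_at sum_ord2 /lam /vanish /= sG s1 eqxx /=.
by rewrite mulNr mulrC subrr.
Qed.

(** If all covariants were parallel, some nonzero [z] would have bracket 0 with each of them. By
    [cov_span], applied to the bracket with [z], all points of [A] would then coincide with [z], but
    [A] has two distinct ones. *)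
Lemma cov_independent : (1 < #|A|)%N ->
  exists (h : 'I_2 -> {ffun idx -> 'I_2}) (a : 'I_2 -> 'I_n),
    (forall e, a e \in A) /\ dt (covec (h 0) (a 0) u) (covec (h 1) (a 1) u) != 0.
Proof.
case/card_gt1P=> a1 [a2 [a1A a2A a12]].
pose L (x : {ffun idx -> 'I_2} * 'I_n) := covec x.1 x.2 u.
have [/existsP[x /existsP[y /and3P[xA yA xy]]]|no] :=
    boolP [exists x, exists y, [&& x.2 \in A, y.2 \in A & dt (L x) (L y) != 0]].
  exists (fun e => if e == 0 then x.1 else y.1),
    (fun e => if e == 0 then x.2 else y.2); split=> // e.
  by case: ifP.
have {}no x y : x.2 \in A -> y.2 \in A -> dt (L x) (L y) = 0.
  move=> xA yA; apply/eqP; apply: contraNT no => xy.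
  by apply/existsP; exists x; apply/existsP; exists y; rewrite xA yA.
have [z [[c zc] Lz]] : exists z : 'I_2 -> K, (exists c, z c != 0) /\
    forall x, x.2 \in A -> dt (L x) z = 0.
  have [/existsP[x /existsP[c /andP[xA xc]]]|L0] :=
      boolP [exists x, exists c, (x.2 \in A) && (L x c != 0)].
    by exists (L x); split=> [|y yA]; [exists c|apply: no].
  exists (fun=> 1); split=> [|x xA]; first by exists 0; apply: oner_neq0.
  have Lx0 c : L x c = 0.
    apply/eqP; apply: contraNT L0 => xc.
    by apply/existsP; exists x; apply/existsP; exists c; rewrite xA.
  by rewrite /dt !Lx0 !mul0r subrr.
have uz a : a \in A -> dt (fun e => u (a, e)) z = 0.
  move=> aA; apply: (cov_span (f := fun a => dt (fun e => u (a, e)) z) aA) => h.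
  by rewrite -dt_covec (Lz (h, a)).
have := iffLR (disc_neq0P u) du a1 a2 a12; case/negP.
have h1 := uz _ a1A; have h2 := uz _ a2A.
have : br u a1 a2 * z c = 0.
  transitivity (dt (fun e => u (a1, e)) z * u (a2, c)
    - dt (fun e => u (a2, e)) z * u (a1, c)).
    by rewrite /br /dt; elim/ord2_ind: c {zc}; ring.
  by rewrite h1 h2 !mul0r subrr.
by move/eqP; rewrite mulf_eq0 (negPf zc) orbF.
Qed.

End Independent.

End Covariant.

(** * Adding a point on the universal curve *)

Lemma eq_dt (R : comNzRingType) (x x' y y' : 'I_2 -> R) :
  x =1 x' -> y =1 y' -> dt x y = dt x' y'.
Proof. by move=> xx' yy'; rewrite /dt !xx' !yy'. Qed.

Section Pairing.

Variables (S : mspace) (F F' : natmap S (projsp 2)).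

Lemma dtm_natural : natural (fun R (x : coord S -> R) (_ : 'I_1) => dt (F R x) (F' R x)).
Proof.
move=> R R' f x x' xx' _; rewrite /dt rmorphB !rmorphM.
by rewrite !(nm_nat F xx') !(nm_nat F' xx').
Qed.

Lemma dtm_graded : @graded S (projsp 1)
  (fun R (x : coord S -> R) (_ : 'I_1) => dt (F R x) (F' R x))
  (fun _ i => nm_deg F tt i + nm_deg F' tt i)%N.
Proof.
move=> R c x j; rewrite /dt !nm_graded /=.
under [in RHS]eq_bigr => i _ do rewrite exprD.
by rewrite big_split /=; ring.
Qed.

Definition dtm : natmap S (projsp 1) :=
  @NatMap S (projsp 1) _ _ dtm_natural dtm_graded.

End Pairing.

Section Stable.

Variables (k : fieldType) (K : closedFieldType) (iota : {rmorphism k -> K}).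
Variables (m : nat) (n4 : (4 <= m.+2)%N) (G : {group 'S_m.+2}).

Let n := m.+2.
Variable A : {set 'I_n}.
Hypothesis oddA : odd #|A|.
Hypothesis A1 : (1 < #|A|)%N.
Hypothesis GA : forall g : 'S_n, g \in G -> g @: A = A.
Hypothesis freeG : forall g : 'S_n, g \in G -> (5 <= n)%N \/ (exists i, g i = i).

Let pt : finType := option 'I_n.
Let SP : mspace := prodsp (crsp n) (projsp 2).
Let X : vec K SP -> Prop := prodset (@Mbar K n) (@is_pt K (projsp 2)).
Let act : 'S_n -> vec K SP -> vec K SP := prodact (T := projsp 2) (@Mbar_act K n).

Lemma Mbar_P1_free : generically_free G X act.
Proof.
have [D [natD [u Du] freeD]] := free_ex K n4 freeG.
apply: (dense_Mbar_P1 (ltnW n4) (D := fun R v j => D R (fun l => v (inl l)) j)).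
- by move=> R R' f v v' vv' j; apply: natD => l; apply: vv'.
- by exists (fun l => if l is inl l' then u l' else 0).
move=> v _ Dv g gG [c c0 cE]; apply/eqP/negPn/negP => g1.
have [_ /(_ g gG g1)[q]] := freeD _ Dv.
rewrite (eqpt_moved q) ?eqxx //; exists (fun q => c (inl q)) => // j.
exact: (cE (inl j)).
Qed.

Variables (a b c : 'I_n) (qd : 'I_n -> quad n).
Hypotheses (ab : a != b) (ac : a != c) (bc : b != c).
Hypothesis qdE : forall i, i != a -> i != b -> i != c ->
  [/\ val (qd i) 0 = i, val (qd i) 1 = b, val (qd i) 2 = a & val (qd i) 3 = c].

Variables (hh : 'I_2 -> {ffun (quad n * 'S_n)%type -> 'I_2}) (aa : 'I_2 -> 'I_n).
Hypothesis aaA : forall e, aa e \in A.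
Hypothesis independent : exists u : 'I_n * 'I_2 -> K,
  dt (covec G A (hh 0) (aa 0) u) (covec G A (hh 1) (aa 1) u) != 0.

Let covm (e : 'I_2) : natmap (confsp 'I_n) (projsp 2) :=
  @NatMap (confsp 'I_n) (projsp 2) _ _
    (@covec_natural n G A (hh e) (aa e))
    (@covec_graded n G A oddA GA (hh e) (aa e) (aaA e)).

Let finpts : natmap (confsp pt) (confsp 'I_n) := relabelm Some.
Let infpt : natmap (confsp pt) (projsp 2) :=
  @perm_nm (confsp pt) (projsp 2) (fun e => (None, e)) (fun _ => None) (fun _ => erefl).

Let psi_fun (R : comNzRingType) (p : pt * 'I_2 -> R) (j : coord SP) : R :=
  match j with
  | inl l => crm n R (finpts R p) l
  | inr e => dt (covm e R (finpts R p)) (infpt R p)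
  end.

(** The multidegree [cov_deg] does not depend on [hh] and [aa], so [covm 0] gives the degree of both
    coordinates on P^1. *)
Let psi_deg (i : factor SP) : pt -> nat :=
  match i with
  | inl q => nm_deg (comp_nm (crm n) finpts) q
  | inr _ => nm_deg (dtm (comp_nm (covm 0) finpts) infpt) tt
  end.

Let psi_natural : natural psi_fun.
Proof.
move=> R R' f p p' pp' [l|e].
  exact: (nm_nat (comp_nm (crm n) finpts)).
exact: (nm_nat (dtm (comp_nm (covm e) finpts) infpt) pp' ord0).
Qed.

Let psi_graded : @graded (confsp pt) SP psi_fun psi_deg.
Proof.
move=> R g p [l|e].
  exact: (nm_graded (comp_nm (crm n) finpts)).
exact: (nm_graded (dtm (comp_nm (covm e) finpts) infpt) g p ord0).
Qed.

Let Psi : natmap (confsp pt) SP := 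
  @NatMap (confsp pt) SP _ _ psi_natural psi_graded.

Let pr1 : natmap SP (crsp n) := @perm_nm SP (crsp n) inl inl (fun _ => erefl).
Let pr2 : natmap SP (projsp 2) := @perm_nm SP (projsp 2) inr inr (fun _ => erefl).
Let base : natmap SP (confsp 'I_n) := comp_nm (normm a b c qd) pr1.

(* The last point [w_1 L_0 - w_0 L_1] is the one at which the linear forms
   [dt L_0] and [dt L_1] have ratio [w_0 : w_1]. *)
Let theta_fun (R : comNzRingType) (x : coord SP -> R) (l : pt * 'I_2) : R :=
  match l.1 with
  | Some i => base R x (i, l.2)
  | None => x (inr 1) * covm 0 R (base R x) l.2
            - x (inr 0) * covm 1 R (base R x) l.2
  end.

Let theta_deg (s : pt) : factor SP -> nat :=
  match s with
  | Some i => nm_deg base i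
  | None => fun t => (nm_deg pr2 tt t + nm_deg (comp_nm (covm 0%R) base) tt t)%N
  end.

Let theta_natural : natural theta_fun.
Proof.
move=> R R' f x x' xx' [[i|] e]; rewrite /theta_fun /=.
  exact: (nm_nat base).
have E d : covm d R' (base R' x') e = f (covm d R (base R x) e) :=
  nm_nat (comp_nm (covm d) base) xx' e.
by rewrite rmorphB !rmorphM !xx' -!E.
Qed.

Let theta_graded : @graded SP (confsp pt) theta_fun theta_deg.
Proof.
move=> R g x [[i|] e]; rewrite /theta_fun.
  exact: (nm_graded base).
set gx := fun l => _.
have E d : covm d R (base R gx) e
    = (\prod_t g t ^+ nm_deg (comp_nm (covm 0) base) tt t)
      * covm d R (base R x) e := nm_graded (comp_nm (covm d) base) g x e.
have W d : gx (inr d) = (\prod_t g t ^+ nm_deg pr2 tt t) * x (inr d) :=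
  nm_graded pr2 g x d.
rewrite -[LHS]/(gx (inr 1) * covm 0 R (base R gx) e
  - gx (inr 0) * covm 1 R (base R gx) e).
rewrite -[RHS]/((\prod_t g t ^+ theta_deg None t)
  * (x (inr 1) * covm 0 R (base R x) e - x (inr 0) * covm 1 R (base R x) e)).
have -> : \prod_t g t ^+ theta_deg None t = (\prod_t g t ^+ nm_deg pr2 tt t)
    * (\prod_t g t ^+ nm_deg (comp_nm (covm 0) base) tt t).
  by rewrite -big_split; apply: eq_bigr => t _; apply: exprD.
rewrite !E !W; move: (covm 0 R _ e) (covm 1 R _ e) => y y'.
by ring.
Qed.

Let Theta : natmap SP (confsp pt) := 
  @NatMap SP (confsp pt) _ _ theta_natural theta_graded.

Let jac : natmap (confsp 'I_n) (projsp 1) := dtm (covm 0) (covm 1).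
(** Where [jac] vanishes, the two covariants are parallel and the coordinate on P^1 no longer
    determines the added point. *)
Let Dl : natmap (confsp pt) (projsp 1) := mul_nm (discm pt) (comp_nm jac finpts).

Let L (e : 'I_2) (u : 'I_n * 'I_2 -> K) : 'I_2 -> K := covm e K u.
Let J (u : 'I_n * 'I_2 -> K) : K := dt (L 0 u) (L 1 u).
Let E (d : K) (g : 'I_n -> K) : K := d ^+ cov_exp A * cov_factor A g.

Let E_neq0 d g : d != 0 -> (forall i, g i != 0) -> E d g != 0.
Proof.
move=> d0 g0; rewrite /E mulf_neq0 ?expf_neq0 // /cov_factor.
by rewrite mulf_neq0 // prodf_seq_neq0; apply/allP => x _ //; apply/implyP.
Qed.

Let dt_L_scale e u u' d g t x x' :
  (forall i j, br u' i j = d * g i * g j * br u i j) ->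
  (forall i, dt (fun a => u' (i, a)) x' = t * g i * dt (fun a => u (i, a)) x) ->
  dt (L e u') x' = E d g * t * dt (L e u) x.
Proof. by move=> uE fE; rewrite /L /= !dt_covec; apply: cov_scale. Qed.

Let dt_L_scale_r e u u' d g t x x' :
  (forall i j, br u' i j = d * g i * g j * br u i j) ->
  (forall i, dt x' (fun a => u' (i, a)) = t * g i * dt x (fun a => u (i, a))) ->
  dt x' (L e u') = E d g * t * dt x (L e u).
Proof. by move=> uE fE; rewrite /L /= !dt_covecr; apply: cov_scale. Qed.

Let dt_pt_L_scale e u u' d g i :
  (forall i j, br u' i j = d * g i * g j * br u i j) ->
  dt (fun a => u' (i, a)) (L e u') = E d g * (d * g i) * dt (fun a => u (i, a)) (L e u).
Proof. by move=> uE; apply: dt_L_scale_r => // j; apply: uE. Qed.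

Let J_scale u u' d g :
  (forall i j, br u' i j = d * g i * g j * br u i j) ->
  J u' = E d g * (E d g * d) * J u.
Proof.
move=> uE; apply: dt_L_scale => // i; rewrite (dt_pt_L_scale 1 i uE).
by rewrite !mulrA.
Qed.

Let good (p : vec K (confsp pt)) : Prop := Dl K p ord0 != 0.

Let goodP p : good p <-> disc p != 0 /\ J (finpts K p) != 0.
Proof.
rewrite /good /= mulf_eq0 negb_or; split; first by move/andP.
by case=> -> ->.
Qed.

Let good_sim (p p' : vec K (confsp pt)) : sim p p' -> good p -> good p'.
Proof.
move=> pp' /goodP[dp Jp]; apply/goodP; split; first exact: sim_disc dp.
have [d [g [d0 g0 brE]]] := pp'.
rewrite (@J_scale (finpts K p) _ d (fun i => g (Some i))) => [|i j]; last exact: brE.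
have E0 := E_neq0 d0 (fun i => g0 (Some i)).
exact: mulf_neq0 (mulf_neq0 E0 (mulf_neq0 E0 d0)) Jp.
Qed.

Let rho (g : 'S_n) (i : 'I_n) : 'I_n := (g^-1)%g i.

Let rho1 i : rho 1%g i = i.
Proof. by rewrite /rho invg1 perm1. Qed.

Let rhoM : {in G &, forall g h i, rho (g * h)%g i = rho g (rho h i)}.
Proof. by move=> g h _ _ i; rewrite /rho invMg permM. Qed.

Let L_act e (p : vec K (confsp pt)) g : g \in G ->
  L e (finpts K (cact rho g p)) =1 L e (finpts K p).
Proof.
move=> gG c'.
exact: (@cov_act n G A K _ _ (br (finpts K p)) (fun i => p (Some i, c')) _ (groupVr gG)).
Qed.

Let good_act g (p : vec K (confsp pt)) : g \in G -> good p -> good (cact rho g p).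
Proof.
move=> gG /goodP[dp Jp]; apply/goodP; split; first exact: (disc_cact rho1 rhoM gG).
by rewrite /J /dt !L_act.
Qed.

Let PsiE (p : vec K (confsp pt)) e :
  Psi K p (inr e) = dt (L e (finpts K p)) (fun a => p (None, a)).
Proof. by []. Qed.

Let Psi_sim (p p' : vec K (confsp pt)) : sim p p' -> eqpt (Psi K p) (Psi K p').
Proof.
move=> [d [g [d0 g0 brE]]].
have brE' i j : br (finpts K p') i j
    = d * g (Some i) * g (Some j) * br (finpts K p) i j by apply: brE.
have [c' c'0 cE] : eqpt (crm n K (finpts K p)) (crm n K (finpts K p')).
  by apply: crm_sim; exists d, (fun i => g (Some i)).
exists (fun i => match i with inl q => c' q
    | inr _ => E d (fun i => g (Some i)) * (d * g None) end) => [[q|_]|[l|e]].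
- exact: c'0.
- exact: mulf_neq0 (E_neq0 d0 (fun i => g0 (Some i))) (mulf_neq0 d0 (g0 _)).
- exact: cE.
rewrite !PsiE; apply: dt_L_scale => // i.
by rewrite -[LHS]/(br p' (Some i) None) brE [d * g _ * _]mulrAC.
Qed.

Let theta_J (w : 'I_2 -> K) u e :
  dt (L e u) (fun a => w 1 * L 0 u a - w 0 * L 1 u a) = - J u * w e.
Proof. by rewrite /J /dt; elim/ord2_ind: e; ring. Qed.

(** Cramer's rule: det(L_1, z) L_0 - det(L_0, z) L_1 = - det(L_0, L_1) z, so the added point is
    recovered up to [J]. [Theta] uses the covariants of the normalised points, whence the extra
    factor [E d g]. *)
Let ThetaPsi (p : vec K (confsp pt)) : good p -> sim p (Theta K (Psi K p)).
Proof.
move=> /goodP[dp Jp]; set u := finpts K p; set u' := normm a b c qd K (crm n K u).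
have du : disc u != 0 by apply: (disc_comp (f := Some)) dp; apply: Some_inj.
have [d [g [d0 g0 brE]]] := norm_crm_sim ab ac bc qdE du.
have E0 := E_neq0 d0 g0.
pose z' a := Psi K p (inr 1) * L 0 u' a - Psi K p (inr 0) * L 1 u' a.
have uz i : dt (fun a => u' (i, a)) z' = d * g i * (- E d g * J u) * br p (Some i) None.
  transitivity (Psi K p (inr 1) * dt (fun a => u' (i, a)) (L 0 u')
    - Psi K p (inr 0) * dt (fun a => u' (i, a)) (L 1 u')).
    by rewrite /z' /dt; ring.
  rewrite !(@dt_pt_L_scale _ u u' d g) // !PsiE -/u.
  have -> : br p (Some i) None = dt (fun a => u (i, a)) (fun a => p (None, a)) by [].
  by rewrite /J; move: (L 0 u) (L 1 u) (E d g) => x y z; rewrite /dt; ring.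
exists d, (fun s => if s is Some i then g i else - E d g * J u).
split=> // [[i|]|[i|] [j|]] //.
- by apply: mulf_neq0 Jp; rewrite oppr_eq0.
- exact: brE.
- exact: uz.
- rewrite brC [br p _ _]brC -[br _ (Some j) None]/(dt (fun a => u' (j, a)) z') uz.
  by rewrite mulrN; congr (- _); congr (_ * _); rewrite mulrAC.
- by rewrite !brxx mulr0.
Qed.

Let X_pt (x : vec K SP) : X x -> is_pt x.
Proof.
move=> [/Mbar_pt Mx wpt] [q|i].
  by have [j jq xj] := Mx q; exists (inl j); rewrite // -jq.
by have [j ji xj] := wpt i; exists (inr j); rewrite // -ji.
Qed.

Let Psi_X (p : vec K (confsp pt)) (x : vec K SP) :
  good p -> eqpt (Psi K p) x -> X x.
Proof.
move=> /goodP[dp Jp] [g g0 gE]; split.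
  apply: (Mbar_smooth (ltnW n4) (u := finpts K p)).
    by apply: (disc_comp (f := Some)) dp; apply: Some_inj.
  by exists (fun q => g (inl q)) => // j; apply: gE.
have [e xe] : exists e, Psi K p (inr e) != 0.
  have [P0|] := eqVneq (Psi K p (inr 0)) 0; last by exists 0.
  have [P1|] := eqVneq (Psi K p (inr 1)) 0; last by exists 1.
  (* By Cramer's rule again, a vector with bracket 0 against two independent covariants is zero. *)
  have z0 a' : p (None, a') = 0.
    apply: (mulfI Jp); rewrite mulr0.
    transitivity (Psi K p (inr 0) * L 1 (finpts K p) a'
      - Psi K p (inr 1) * L 0 (finpts K p) a').
      rewrite !PsiE /J; move: (L 0 _) (L 1 _) => y y'.
      by rewrite /dt; elim/ord2_ind: a'; ring.
    by rewrite P0 P1 !mul0r subrr.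
  have /disc_neq0P/(_ (Some a) None isT) := dp.
  by rewrite /br /dt !z0 !mulr0 subrr eqxx.
by case; exists e; rewrite // gE mulf_neq0.
Qed.

Let PsiTheta (x : vec K SP) : X x -> good (Theta K x) ->
  eqpt x (Psi K (Theta K x)).
Proof.
move=> [Mx wpt] /goodP[dt Jt]; set u := base K x.
have uE : finpts K (Theta K x) =1 u by case.
have du : disc u != 0.
  apply: (sim_disc (p := finpts K (Theta K x))).
    by apply/eqpt_sim/eqpt_ext.
  by apply: (disc_comp (f := Some)) dt; apply: Some_inj.
have Ju : J u != 0.
  by rewrite -[J u]/(jac K u ord0) -(nm_ext jac uE).
have [g g0 gE] := crm_norm_Mbar ab ac bc qdE Mx du.
exists (fun i => match i with inl q => g q | inr _ => - J u end) => [[q|_]|[l|e]].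
- exact: g0.
- by rewrite oppr_eq0.
- by rewrite -gE; apply: (nm_ext (crm n) uE).
rewrite PsiE -(theta_J (fun e => x (inr e)) u e).
have LE : L e (finpts K (Theta K x)) =1 L e u by apply: (nm_ext (covm e) uE).
exact: eq_dt.
Qed.

Let act_eqpt g (x y : vec K SP) : eqpt x y -> eqpt (act g x) (act g y).
Proof.
move=> [c' c'0 cE]; exists (fun i => match i with
  | inl q => c' (inl (quad_perm g^-1 q)) | inr b => c' (inr b) end).
  by case=> [q|i]; apply: c'0.
by case=> [l|e] /=; apply: cE.
Qed.

Let Psi_act g (p : vec K (confsp pt)) : g \in G -> good p ->
  eqpt (Psi K (cact rho g p)) (act g (Psi K p)).
Proof.
move=> gG _; apply: eqpt_ext => -[[q e]|e].
  by rewrite /= /Mbar_act /= /cr_nat /= /crq /= !ffunE.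
rewrite PsiE /act /= -[RHS]/(Psi K p (inr e)) PsiE /dt !L_act //.
Qed.

Let good_ex : exists p : vec K (confsp pt), good p.
Proof.
have [u Ju] := independent; have [p dp] := distinct_ex K pt.
pose p1 (l : pt * 'I_2) : K := if l.1 is Some i then u (i, l.2) else 0.
have E1 : comp_nm jac finpts K p1 ord0 = jac K u ord0.
  by apply: (nm_ext jac (x := finpts K p1)) => -[].
have Jp : comp_nm jac finpts K p1 ord0 != 0 by rewrite E1.
have [p' [dp' Jp']] := generic_point2 (@disc_natural pt)
  (nm_nat (comp_nm jac finpts)) (j := ord0) dp Jp.
by exists p'; apply/goodP.
Qed.

Let dense_good : dense X (fun x => good (Theta K x)).
Proof.
apply: (dense_Mbar_P1 (ltnW n4)
  (D := fun R v => comp_nm Dl Theta R (pair_nat v))) => //.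
- exact: natural_comp (@pair_natural n) (nm_nat (comp_nm Dl Theta)).
have [p gp] := good_ex.
exists (fun l => match l with inl l' => finpts K p l' | inr e => Psi K p (inr e) end).
have E' : pair_nat (fun l => match l with
    | inl l' => finpts K p l' | inr e => Psi K p (inr e) end) =1 Psi K p by case.
by rewrite (nm_ext (comp_nm Dl Theta) E'); apply: good_sim (ThetaPsi gp) gp.
Qed.

Lemma universal_linearizable : linearizable iota G X act.
Proof.
split; [exact: Mbar_P1_regular|exact: Mbar_P1_free|].
exists m.+1, (diff_repr rho1 rhoM k).
apply: (@criterion_birational k K iota m _ G rho rho1 rhoM SP X act Psi Theta Dl).
- by move=> p /goodP[].
- exact: good_sim.
- exact: good_act.
- exact: good_ex.
- by move=> p p' _; apply: Psi_sim.
- exact: Psi_X.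
- exact: X_pt.
- exact: ThetaPsi.
- exact: PsiTheta.
- exact: act_eqpt.
- exact: Psi_act.
- exact: dense_good.
- by exists (inr tt).
Qed.

End Stable.

(** * Odd invariant subsets *)

Section OddCycle.

Variables (k : fieldType) (K : closedFieldType) (iota : {rmorphism k -> K}).

Lemma odd_stable_large (n : nat) (G : {group 'S_n}) (A : {set 'I_n}) :
  (4 <= n)%N -> odd #|A| -> (1 < #|A|)%N ->
  (forall g : 'S_n, g \in G -> g @: A = A) ->
  stably_linearizable iota G (@Mbar K n) (@Mbar_act K n).
Proof.
case: n G A => [|[|m]] // G A n4 oddA A1 GA.
have freeG (g : 'S_m.+2) : g \in G -> (5 <= m.+2)%N \/ (exists i, g i = i).
  move=> gG; have [n5|n5] := leqP 5 m.+2; [by left|right].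
  (* Here n = 4, and [A], being odd with more than one element, has three: the remaining point is
     fixed by G. *)
  have /eqP/cards1P[i Ai] : #|~: A| = 1%N.
    have m2 : m.+2 = 4%N by apply/eqP; rewrite eqn_leq -ltnS n5 n4.
    have cA := cardsC A; rewrite card_ord in cA.
    move: oddA A1 (etrans cA m2).
    by case: #|A| => [|[|[|[|[|x]]]]] //= _ _ [].
  have gC j : (g j \in ~: A) = (j \in ~: A) by rewrite !inE (stab_mem GA).
  by exists i; apply/set1P; rewrite -Ai gC Ai set11.
have [a [b [c [qd [ab ac bc qdE]]]]] := base_ex n4.
have [D [_ [u Du] freeD]] := free_ex K n4 freeG.
have [du freeu] := freeD u Du.
have [hh [aa [aaA Ju]]] := cov_independent n4 du freeu A1.
(* One factor P^1 suffices: it is the fibre of the universal curve. *)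
exists 1%N; apply: (universal_linearizable iota n4 oddA GA freeG ab ac bc qdE (hh := hh) aaA).
by exists u; exact: Ju.
Qed.

(** A single invariant point does not give two independent covariants. It is replaced by the whole
    set if n is odd, and by its complement if n is even; both are odd with at least three
    elements. *)
Lemma odd_stable (n : nat) (G : {group 'S_n}) (A : {set 'I_n}) :
  (4 <= n)%N -> odd #|A| -> (forall g : 'S_n, g \in G -> g @: A = A) ->
  stably_linearizable iota G (@Mbar K n) (@Mbar_act K n).
Proof.
move=> n4 oddA GA; have [A1|A1] := ltnP 1 #|A|.
  exact: odd_stable_large A1 GA.
have cA : #|A| = 1%N by apply/eqP; rewrite eqn_leq A1; case: #|A| oddA.
have [on|en] := boolP (odd n).
  apply: (@odd_stable_large n G setT) => //; rewrite ?cardsT ?card_ord //.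
    exact: leq_trans n4.
  move=> g gG; apply/setP => i; rewrite inE -[i](permKV g) mem_imset ?inE //.
  exact: perm_inj.
have cAC : #|~: A| = n.-1 by rewrite cardsCs setCK card_ord cA subn1.
apply: (@odd_stable_large n G (~: A)) => //; rewrite ?cAC.
- by case: n n4 en {G A oddA GA A1 cA cAC} => //= n _; rewrite negbK.
- by case: n n4 {G A oddA GA A1 cA cAC en} => // n; apply: (@leq_trans 3).
move=> g gG; apply/setP => i; rewrite -[i](permKV g) mem_imset; last exact: perm_inj.
by rewrite !inE [in RHS](stab_mem GA).
Qed.

End OddCycle.

Theorem proposition2 (k : fieldType) (K : closedFieldType)
    (iota : {rmorphism k -> K}) (n : nat) (hn : (4 <= n)%N) :
  [/\ forall G : {group 'S_n},
        (forall (g : 'S_n) (i : 'I_n), g \in G -> val i = n.-1 -> g i = i) ->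
        linearizable iota G (@Mbar K n) (@Mbar_act K n),
      forall (m : nat) (G : {group 'S_n}), n = (2 * m + 1)%N ->
        stably_linearizable iota G (@Mbar K n) (@Mbar_act K n)
    & forall (G : {group 'S_n}) (A : {set 'I_n}), odd #|A| ->
        (forall g : 'S_n, g \in G -> g @: A = A) ->
        stably_linearizable iota G (@Mbar K n) (@Mbar_act K n)].
Proof.
split=> [G fixG|m G nE|G A oddA GA].
- case: n hn G fixG => [|[|[|m]]] // hn G fixG.
  by apply: fixed_linearizable => // g gG; apply: fixG.
(* The whole set of marked points is odd and invariant. *)
- apply: (@odd_stable _ _ _ n G setT) => //.
    by rewrite cardsT card_ord nE oddD oddM.
  move=> g gG; apply/setP => i; rewrite inE -[i](permKV g) mem_imset ?inE //.
  exact: perm_inj.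
- exact: odd_stable GA.
Qed.
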